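(* Let $p$ be a prime and let $G=\mathbf{Q}_p^\times$ (the multiplicative group of the field of $p$-adic numbers, with its usual locally compact topology). Let $N\subset\mathcal{C}(G)$ be the set of open subgroups of finite index of $G$. Then: (1) $\mathcal{C}(G)$ is a proper compactification of $\mathbf{N}$, with $N$ as the open, countable, dense, discrete subset; i.e. $\mathcal{C}(G)$ is a compact metric space in which $N$ is an open, countable, dense, discrete subset. (2) If $p$ is odd, $\mathcal{C}(G)\smallsetminus N$ is homeomorphic to the space obtained from the disjoint union of the Cantor space $C$ and $[d(p-1)]\times\overline{\mathbf{N}}$ by identifying the $d(p-1)$ accumulation points $(i,\infty)$, $i\in[d(p-1)]$, of $[d(p-1)]\times\overline{\mathbf{N}}$ with $d(p-1)$ pairwise distinct points of $C$. (3) If $p=2$, $\mathcal{C}(G)\smallsetminus N$ is homeomorphic to the space obtained from the disjoint union of the Cantor space $C$ and $[2]\times\overline{\mathbf{N}}$ by identifying the $2$ accumulation points $(1,\infty),(2,\infty)$ of $[2]\times\overline{\mathbf{N}}$ with $2$ pairwise distinct points of $C$.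
   Context: For a locally compact space $X$, $\mathcal{F}(X)$ denotes the set of closed subsets of $X$ with the Chabauty topology, whose open sets are generated by finite intersections of sets $\{F\in\mathcal{F}(X):F\cap K=\emptyset\}$ for $K\subset X$ compact and $\{F\in\mathcal{F}(X):F\cap U\neq\emptyset\}$ for $U\subset X$ open. For a locally compact group $G$, $\mathcal{C}(G)\subset\mathcal{F}(G)$ is the (closed, hence compact) subspace of closed subgroups of $G$, the Chabauty space of $G$. A compact metric space $Y$ is a proper compactification of $\mathbf{N}$ if it contains an open, countable, dense, discrete subset. $\overline{\mathbf{N}}=\mathbf{N}\cup\{\infty\}$ is the one-point compactification of $\mathbf{N}$, $C$ is the Cantor space, $[k]=\{1,\dots,k\}$, and $d(n)$ is the number of positive divisors of $n$. *)

(* Defs.v *)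
From HB Require Import structures.
From mathcomp Require Import all_boot all_order all_algebra.
From mathcomp Require Import all_classical all_reals all_analysis.

Set Implicit Arguments.
Unset Strict Implicit.
Unset Printing Implicit Defensive.

Local Open Scope classical_set_scope.

Definition metrizable (T : topologicalType) : Prop :=
  exists (R : realType) (d : T -> T -> R),
    [/\ (forall x y, d x y = 0%R <-> x = y),
        (forall x y, d x y = d y x),
        (forall x y z, d x z <= d x y + d y z)%R &
        (forall x, nbhs x = filter_from [set e | (0 < e)%R]
                                        (fun e => [set y | (d x y < e)%R]))].

Definition discrete_subset (T : topologicalType) (N : set T) : Prop :=
  forall x, N x -> exists U : set T, [/\ open U, U x & U `&` N = [set x]].

Definition proper_compactification_of_N (Y : topologicalType) (N0 : set Y) :=
  [/\ compact [set: Y], metrizable Y, open N0, countable N0 &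
      (dense N0 /\ discrete_subset N0)].
Arguments proper_compactification_of_N : clear implicits.

Definition homeomorphic (S T : topologicalType) : Prop :=
  exists (f : S -> T) (g : T -> S),
    [/\ cancel f g, cancel g f, continuous f & continuous g].

(* Carrier: subsets of X; the Chabauty space F(X) is the subspace of closed
   subsets (see chabauty_closed_sets below). *)
Definition chabauty (X : topologicalType) : Type := set X.

Section Chabauty.
Variable X : topologicalType.

HB.instance Definition _ := Pointed.on (chabauty X).

Definition chabauty_index : set (set X * bool) :=
  [set Kb | if Kb.2 then compact Kb.1 else open Kb.1].

Definition chabauty_subbasic (Kb : set X * bool) : set (chabauty X) :=
  if Kb.2 then [set F : chabauty X | F `&` Kb.1 = set0]
  else [set F : chabauty X | F `&` Kb.1 !=set0].

HB.instance Definition _ :=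
  isSubBaseTopological.Build (chabauty X) chabauty_index chabauty_subbasic.

Definition closed_sets : set (chabauty X) := [set F | closed (F : set X)].

End Chabauty.

(* Z_p as the inverse limit of Z/p^n Z: x n in [0, p^n) is the residue mod
   p^n, compatible under reduction; topology = subspace of the product of the
   discrete spaces. *)
Definition seqs : Type := prod_topology (fun _ : nat => nat).

Definition zp_set (p : nat) : set seqs :=
  [set x | forall n, x n < p ^ n /\ x n.+1 %% p ^ n = x n]%N.

(* units of Z_p: the residue mod p is invertible. *)
Definition zpu_set (p : nat) : set seqs :=
  [set x | zp_set p x /\ coprime (x 1%N) p].

Definition Zpu (p : nat) : topologicalType := set_type (zpu_set p).

(* Q_p^x = p^Z x Z_p^x: (k, u) stands for p^k u; as topological space the
   disjoint union over k in Z of copies of Z_p^x (i.e. Z discrete x Z_p^x). *)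
Definition Qpx (p : nat) : topologicalType := {k : int & Zpu p}.

Definition zp_mul_seq (p : nat) (x y : seqs) : seqs :=
  fun n => (x n * y n %% p ^ n)%N.

Lemma zpu_mul_in (p : nat) (x y : Zpu p) :
  zp_mul_seq p (val x) (val y) \in zpu_set p.
Proof.
case: x => x hx0; case: y => y hy0 /=.
move/set_mem: hx0 => [hx cx]; move/set_mem: hy0 => [hy cy].
apply/mem_set; have p0 : (0 < p)%N.
  by case: (hx 1%N); rewrite expn1; case: p {hx hy cx cy} => //.
split; last by rewrite /zp_mul_seq expn1 coprime_modl coprimeMl cx cy.
move=> n; split; first by rewrite /zp_mul_seq ltn_pmod // expn_gt0 p0.
rewrite /zp_mul_seq modn_dvdm; last by rewrite dvdn_exp2l.
by rewrite -(proj2 (hx n)) -(proj2 (hy n)) modnMm.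
Qed.

Definition zpu_mul (p : nat) (x y : Zpu p) : Zpu p :=
  exist _ (zp_mul_seq p (val x) (val y)) (zpu_mul_in x y).

Definition qpx_mul (p : nat) (a b : Qpx p) : Qpx p :=
  existT _ (projT1 a + projT1 b)%R (zpu_mul (projT2 a) (projT2 b)).

(* H is a subgroup (one-step test: nonempty and a * b^-1 in H for a, b in H,
   where a * b^-1 is the unique c with c * b = a). *)
Definition qpx_subgroup (p : nat) (H : set (Qpx p)) : Prop :=
  H !=set0 /\
  forall a b c, H a -> H b -> qpx_mul c b = a -> H c.

Definition qpx_finite_index (p : nat) (H : set (Qpx p)) : Prop :=
  exists S : set (Qpx p), finite_set S /\
    forall g, exists x h, [/\ S x, H h & g = qpx_mul x h].

Definition closed_subgroups (p : nat) : set (chabauty (Qpx p)) :=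
  [set H | @closed_sets (Qpx p) H /\ qpx_subgroup H].
Arguments closed_subgroups : clear implicits.

Definition CG (p : nat) : topologicalType := set_type (closed_subgroups p).

Definition open_fin_index (p : nat) : set (CG p) :=
  [set H | open (val H : set (Qpx p)) /\ qpx_finite_index (val H)].
Arguments open_fin_index : clear implicits.

Definition CG_minus_N (p : nat) : topologicalType :=
  set_type (~` open_fin_index p).

(* [k] x N-bar, with [k] = 'I_k discrete and N-bar the one-point
   compactification of N (None is the point at infinity). *)
Definition kNbar (k : nat) : topologicalType :=
  {i : 'I_k & one_point_compactification nat}.

Definition glue_fam (k : nat) (b : bool) : topologicalType :=
  if b then (cantor_space : topologicalType) else kNbar k.
Definition disj_union (k : nat) : topologicalType := {b : bool & glue_fam k b}.

(* Set of equivalence classes, represented by: points of C, and points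
   (i, n) with n finite. *)
Definition glued_carrier (k : nat) : Type := (cantor_space + ('I_k * nat))%type.



Definition glue_map (k : nat) (c : 'I_k -> cantor_space) (z : disj_union k)
  : glued_carrier k :=
  match z with
  | existT true x => inl x
  | existT false y =>
      match projT2 y with
      | Some n => inr (projT1 y, n)
      | None => inl (c (projT1 y))
      end
  end.

Definition glued (k : nat) (c : 'I_k -> cantor_space) : Type := glued_carrier k.
Arguments glued : clear implicits.

HB.instance Definition _ k c := Choice.on (glued k c).

Section Glued.
Variables (k : nat) (c : 'I_k -> cantor_space).

Definition glued_open (U : set (glued k c)) : Prop :=
  open (glue_map c @^-1` U).

Lemma glued_openT : glued_open setT.
Proof. by rewrite /glued_open preimage_setT; exact: openT. Qed.

Lemma glued_openI A B : glued_open A -> glued_open B -> glued_open (A `&` B).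
Proof. by move=> oA oB; rewrite /glued_open preimage_setI; exact: openI. Qed.

Lemma glued_openU (I : Type) (f : I -> set (glued k c)) :
  (forall i, glued_open (f i)) -> glued_open (\bigcup_i f i).
Proof.
move=> hf; rewrite /glued_open preimage_bigcup.
by apply: bigcup_open => i _; exact: hf.
Qed.

HB.instance Definition _ :=
  isOpenTopological.Build (glued k c) glued_openT glued_openI glued_openU.

End Glued.

(* Main.v *)
(** A closed subgroup H of Q_p^x = Z x Z_p^x is determined by its unit part
    V = H \cap Z_p^x and, if H is not contained in Z_p^x, by a generator (m, u)
    of H modulo V.  A closed subgroup V of Z_p^x that contains a nontrivial unit
    congruent to 1 modulo p (modulo 4 if p = 2) is open, since the p-power map
    raises the level of such a unit by exactly one; otherwise V is a finite group
    of roots of unity, determined by its order, which divides p - 1 (resp. 2).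
    So H has finite index iff V is open and m > 0, in which case H is isolated in
    C(G).  In the complement of N, the subgroups with V open (hence m = 0) are
    isolated and accumulate exactly at the finite subgroups of Z_p^x, while those
    with V finite form a compact perfect zero-dimensional set.  The latter is a
    Cantor space by Brouwer's theorem, and homeomorphisms of the Cantor space act
    transitively on tuples of distinct points, so the gluing points can be
    prescribed. *)
Require Import Defs.
From HB Require Import structures.
From mathcomp Require Import all_boot all_order all_algebra all_solvable all_field.
From mathcomp Require Import finmap zify ring.
From mathcomp Require Import all_classical all_reals all_analysis Rstruct.

Set Implicit Arguments.
Unset Strict Implicit.
Unset Printing Implicit Defensive.
Import Order.TTheory GRing.Theory Num.Theory.

Local Open Scope classical_set_scope.

(** * Topologies generated by nested equivalence relations *)

(** The Cantor space, the groups and the Chabauty spaces all get a sequence of nested equivalence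
    relations whose classes form neighbourhood bases. Metrizability and zero-dimensionality come
    from this alone, and closeness of two subgroups becomes finite data: at level [n] they meet the
    same classes modulo [p ^ n] among the elements of degree at most [n] in absolute value. Two
    degenerations drive the proof. A generator whose degree exceeds the window is invisible, so
    subgroups with [m] tending to infinity approach their unit part; and [V] is the limit of its
    open thickenings V(1 + p^n Z_p). They yield density of [N], perfectness and the accumulation
    points. Conversely, an element of nonzero degree is visible to all close subgroups, so a limit
    of subgroups of degree 0 has degree 0; this is why only the finite subgroups of units carry a
    sequence. The threshold 4 for p = 2 is forced by -1, which is 1 modulo 2 and squares to 1. The
    homeomorphism is built out of the glued space: its source is compact and its target Hausdorff,
    so a continuous bijection suffices. *)

Record ultra_base (X : topologicalType) (E : nat -> X -> set X) : Prop :=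
  UltraBase {
    ub_refl : forall n x, E n x x;
    ub_sym : forall n x y, E n x y -> E n y x;
    ub_trans : forall n x y z, E n x y -> E n y z -> E n x z;
    ub_mono : forall m n x y, (m <= n)%N -> E n x y -> E m x y;
    ub_sep : forall x y, (forall n, E n x y) -> x = y;
    ub_nbhs : forall x (A : set X), nbhs x A <-> exists n, E n x `<=` A }.

Section UltraBase.
Variables (X : topologicalType) (E : nat -> X -> set X).
Hypothesis uE : ultra_base E.

Lemma ub_nbhsE n x : nbhs x (E n x).
Proof. by apply/(ub_nbhs uE); exists n. Qed.

Lemma ub_openP (A : set X) :
  open A <-> forall x, A x -> exists n, E n x `<=` A.
Proof.
rewrite openE; split=> [oA x Ax|h x Ax]; first exact/(ub_nbhs uE)/oA.
exact/(ub_nbhs uE)/h.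
Qed.

Lemma ub_open n x : open (E n x).
Proof.
apply/ub_openP => y Exy; exists n => z; exact: (ub_trans uE).
Qed.

Lemma ub_clopen n x : clopen (E n x).
Proof.
split; first exact: ub_open.
rewrite -openC; apply/ub_openP => y nExy; exists n => z Eyz Exz; apply: nExy.
exact: (ub_trans uE) Exz (ub_sym uE Eyz).
Qed.

Lemma ub_hausdorff : hausdorff_space X.
Proof.
move=> x y cxy; apply: (ub_sep uE) => n.
have [z [Exz Eyz]] := cxy _ _ (ub_nbhsE n x) (ub_nbhsE n y).
exact: (ub_trans uE) Exz (ub_sym uE Eyz).
Qed.

Lemma ub_neq x y : x <> y -> exists n, ~ E n x y.
Proof. by move=> xy; apply/existsNP => h; exact/xy/(ub_sep uE). Qed.

Lemma ub_zero_dimensional : zero_dimensional X.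
Proof.
move=> x y /eqP /ub_neq[n nE]; exists (E n x); split => //.
- exact: ub_clopen.
- exact: (ub_refl uE).
Qed.

(** Compactness is used in its near-covering form, along the filter of finite lists of points of [A]
    ordered by inclusion: near each [x], every list containing [x] already covers. The radius [r]
    may vary with the centre. *)
Lemma ub_finite_cover (A : set X) (r : X -> nat) : compact A ->
  exists s : seq X, (forall x, x \in s -> A x) /\
    (forall x, A x -> exists2 y, y \in s & E (r y) y x).
Proof.
pose F : set_system (seq X) := filter_from
  [set s : seq X | forall x, x \in s -> A x]
  (fun s => [set t : seq X | (forall x, x \in t -> A x) /\ {subset s <= t}]).
have FF : Filter F.
  apply: filter_from_filter; first by exists [::].
  move=> s t sA tA; exists (s ++ t) => [x|u [uA stu]].
    by rewrite mem_cat => /orP[/sA|/tA].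
  by split; split=> // x xs; apply: stu; rewrite mem_cat xs ?orbT.
move/compact_near_coveringP/(_ _ F (fun s x => exists2 y, y \in s & E (r y) y x)).
case=> // [x Ax|s sA As].
  exists (E (r x) x, [set t : seq X | (forall x, x \in t -> A x) /\ x \in t]) => /=.
    split; first exact: ub_nbhsE.
    exists [:: x] => [y|t [tA xt]]; first by rewrite inE => /eqP ->.
    by split => //; apply: xt; rewrite inE.
  by move=> [y t] [/= Exy [tA xt]]; exists x.
by exists s; split=> //; exact: (As s (conj sA (fun _ h => h))).
Qed.

(** Without an accumulation point, every [x] has a class meeting [A] at most in [x]; the centres of
    a finite cover by such classes then contain [A]. *)
Lemma ub_accumulation (A : set X) : compact [set: X] -> infinite_set A ->
  exists x, forall n, exists y, [/\ A y, E n x y & y <> x].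
Proof.
move=> cX infA; apply: contrapT => /forallNP nacc; apply: infA.
have /choice[r hr] : forall x, exists n, forall y, A y -> E n x y -> y = x.
  move=> x; have /existsNP[n hn] := nacc x; exists n => y Ay Exy.
  by apply: contrapT => yx; apply: hn; exists y.
have [s [_ hs]] := ub_finite_cover r cX.
apply: (@sub_finite_set _ _ [set` s]); last exact: finite_seq.
by move=> x Ax; have [y ys /(hr _ _ Ax) ->] := hs x I.
Qed.

(** Sort the points by a level [n] at which their class is a singleton. For fixed [n] there are
    finitely many, since finitely many classes of level [n] cover the space. *)
Lemma ub_countable_isolated (A : set X) : compact [set: X] ->
  (forall x, A x -> open [set x]) -> countable A.
Proof.
move=> cX oA.
suff -> : A = \bigcup_n (A `&` [set x | E n x `<=` [set x]]).
  apply: bigcup_countable => // n _; apply: finite_set_countable.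
  have [s [_ hs]] := ub_finite_cover (fun=> n) cX.
  apply: (@sub_finite_set _ _ [set` s]); last exact: finite_seq.
  move=> x [Ax Ex]; have [y ys Eyx] := hs x I.
  by have <- := Ex y (ub_sym uE Eyx).
apply/seteqP; split=> [x Ax|x [n _ []//]].
by have /ub_openP/(_ x erefl)[n hn] := oA x Ax; exists n.
Qed.

Lemma ub_set_type (A : set X) :
  @ultra_base (set_type A) (fun n x y => E n (val x) (val y)).
Proof.
split=> [n x|n x y|n x y z|m n x y|x y h|x B].
- exact: (ub_refl uE).
- exact: (ub_sym uE).
- exact: (ub_trans uE).
- exact: (ub_mono uE).
- by apply: val_inj; exact: (ub_sep uE).
rewrite nbhsE; split=> [[W [[V oV <-] Vx VB]]|[n EB]].
  have /ub_openP/(_ _ Vx)[n EV] := oV; exists n => y /EV Vy; exact: VB.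
exists (val @^-1` (E n (val x))) => //; split; last exact: (ub_refl uE).
by exists (E n (val x)) => //; exact: ub_open.
Qed.

Section Distance.
Variable R : realType.
Local Open Scope ring_scope.

Definition ultra_dist (x y : X) : R :=
  match pselect (exists n, `[< ~ E n x y >]) with
  | left h => (ex_minn h).+1%:R^-1
  | right _ => 0
  end.

Lemma ultra_dist_ge0 x y : 0 <= ultra_dist x y.
Proof. by rewrite /ultra_dist; case: pselect => // h; rewrite invr_ge0. Qed.

Lemma ultra_dist_lt n x y : ultra_dist x y < n.+1%:R^-1 <-> E n x y.
Proof.
rewrite /ultra_dist; case: pselect => [h|h]; last first.
  rewrite invr_gt0 ltr0n; split => // _; apply: contrapT => nE; apply: h.
  by exists n; apply/asboolP.
case: ex_minnP => m /asboolP nEm minm.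
rewrite ltf_pV2 ?posrE ?ltr0n// ltr_nat ltnS; split=> [nm|Exy].
  by apply: contrapT => nE; move/asboolP: nE => /minm; rewrite leqNgt nm.
by rewrite ltnNge; apply/negP => mn; apply: nEm; exact: (ub_mono uE) Exy.
Qed.

Lemma ultra_dist_cases x y :
  ultra_dist x y = 0 \/ exists n, ~ E n x y /\ ultra_dist x y = n.+1%:R^-1.
Proof.
rewrite /ultra_dist; case: pselect => [h|]; last by left.
by right; case: ex_minnP => m /asboolP nEm _; exists m.
Qed.

Lemma ultra_dist_ge n x y : ~ E n x y -> n.+1%:R^-1 <= ultra_dist x y.
Proof. by move=> nE; rewrite leNgt; apply/negP => /ultra_dist_lt. Qed.

Lemma ultra_dist_sym x y : ultra_dist x y = ultra_dist y x.
Proof.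
suff h a b : ultra_dist a b <= ultra_dist b a by apply/eqP; rewrite eq_le !h.
have [->|[n [nE ->]]] := ultra_dist_cases a b; first exact: ultra_dist_ge0.
by apply: ultra_dist_ge => /(ub_sym uE).
Qed.

(** If level [n] separates [x] from [z], then by transitivity it separates one of the two
    intermediate pairs, so a single summand already suffices. *)
Lemma ultra_dist_triangle x y z :
  ultra_dist x z <= ultra_dist x y + ultra_dist y z.
Proof.
have [->|[n [nE ->]]] := ultra_dist_cases x z.
  by rewrite addr_ge0 ?ultra_dist_ge0.
have [Exy|nExy] := pselect (E n x y).
  have nEyz : ~ E n y z by move=> Eyz; exact/nE/(ub_trans uE Exy).
  by rewrite -[leLHS]add0r lerD ?ultra_dist_ge0 ?ultra_dist_ge.
by rewrite -[leLHS]addr0 lerD ?ultra_dist_ge0 ?ultra_dist_ge.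
Qed.

Lemma ultra_dist_refl x : ultra_dist x x = 0.
Proof.
have [//|[n [nE _]]] := ultra_dist_cases x x.
by case: nE; exact: (ub_refl uE).
Qed.

Lemma ultra_dist_eq0 x y : ultra_dist x y = 0 <-> x = y.
Proof.
split=> [d0|<-]; last exact: ultra_dist_refl.
by apply: (ub_sep uE) => n; apply/ultra_dist_lt; rewrite d0 invr_gt0.
Qed.

Lemma ultra_dist_nbhs x (A : set X) : nbhs x A <->
  exists2 e, 0 < e & [set y | ultra_dist x y < e] `<=` A.
Proof.
rewrite (ub_nbhs uE); split=> [[n EA]|[e e0 dA]].
  by exists n.+1%:R^-1 => [|y /ultra_dist_lt/EA//]; rewrite invr_gt0.
have [n ne] := ltr_add_invr e0; rewrite add0r in ne.
by exists n => y /ultra_dist_lt dxy; apply: dA; exact: lt_trans ne.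
Qed.

End Distance.

Lemma ub_metrizable (R : realType) : metrizable X.
Proof.
exists R, (ultra_dist R); split.
- exact: ultra_dist_eq0.
- exact: ultra_dist_sym.
- by move=> x y z; exact: ultra_dist_triangle.
by move=> x; apply/predeqP => A; exact: ultra_dist_nbhs.
Qed.

End UltraBase.

(** An alias of [X] that remembers [uE] and a base point, so that pointed, uniform and pseudometric
    structures can be attached to it; the characterization of the Cantor space is applied to this
    type. *)
Definition ultra_space (X : topologicalType) (E : nat -> X -> set X)
  (uE : ultra_base E) (x0 : X) : Type := X.

Section UltraSpace.
Variables (X : topologicalType) (E : nat -> X -> set X).
Variables (uE : ultra_base E) (x0 : X).
Local Open Scope relation_scope.

HB.instance Definition _ := Topological.copy (ultra_space uE x0) X.
HB.instance Definition _ := isPointed.Build (ultra_space uE x0) x0.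

Let ent : set_system (ultra_space uE x0 * ultra_space uE x0) :=
  filter_from [set: nat] (fun n => [set xy | E n xy.1 xy.2]).

Let ent_filter : Filter ent.
Proof.
apply: filter_from_filter; first by exists 0%N.
move=> m n _ _; exists (maxn m n) => // xy Exy.
by split; apply: (ub_mono uE) Exy; rewrite ?leq_maxl ?leq_maxr.
Qed.

Let ent_diagonal A : ent A -> diagonal `<=` A.
Proof.
by move=> [n _ nA] [x y] /diagonalP ->; apply: nA; exact: (ub_refl uE).
Qed.

Let ent_inv A : ent A -> ent A^-1.
Proof. by move=> [n _ nA]; exists n => // xy Exy; exact/nA/(ub_sym uE). Qed.

Let ent_split A : ent A -> exists2 B, ent B & B \; B `<=` A.
Proof.
move=> [n _ nA]; exists [set xy | E n xy.1 xy.2]; first by exists n.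
by move=> xy [z Exz Ezy]; apply: nA; exact: (ub_trans uE) Exz Ezy.
Qed.

Let ent_nbhs : @nbhs _ (ultra_space uE x0) = nbhs_ ent.
Proof.
apply/funext => x; apply/predeqP => A.
split=> [/(ub_nbhs uE)[n nA]|[B [n _ nB] BA]].
  exists [set xy | E n xy.1 xy.2]; first by exists n.
  by move=> y /xsectionP; exact: nA.
by apply/(ub_nbhs uE); exists n => y Exy; apply/BA/xsectionP/nB.
Qed.

HB.instance Definition _ := Nbhs_isUniform.Build (ultra_space uE x0)
  ent_filter ent_diagonal ent_inv ent_split ent_nbhs.

Variable R : realType.
Local Open Scope ring_scope.

Let d_ball (x : ultra_space uE x0) (e : R) (y : ultra_space uE x0) :=
  ultra_dist E R x y < e.

Let d_ball_center x (e : R) : 0 < e -> d_ball x e x.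
Proof. by rewrite /d_ball (ultra_dist_refl uE). Qed.

Let d_ball_sym x y e : d_ball x e y -> d_ball y e x.
Proof. by rewrite /d_ball (ultra_dist_sym uE). Qed.

Let d_ball_triangle x y z e1 e2 :
  d_ball x e1 y -> d_ball y e2 z -> d_ball x (e1 + e2) z.
Proof.
move=> xy yz; apply: le_lt_trans (ultra_dist_triangle uE R x y z) _.
exact: ltrD.
Qed.

Let d_entourageE : entourage = entourage_ d_ball.
Proof.
apply/predeqP => A; split=> [[n _ nA]|[e e0 dA]].
  exists n.+1%:R^-1 => [|xy /(ultra_dist_lt uE)/nA//].
  by rewrite /= invr_gt0.
have [n ne] := ltr_add_invr e0; rewrite add0r in ne.
by exists n => // xy /(ultra_dist_lt uE R) dxy; apply/dA/(lt_trans dxy).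
Qed.

HB.instance Definition _ := Uniform_isPseudoMetric.Build R (ultra_space uE x0)
  d_ball_center d_ball_sym d_ball_triangle d_entourageE.

End UltraSpace.

Lemma cantor_parametrization (X : topologicalType) (E : nat -> X -> set X) :
  ultra_base E -> compact [set: X] -> [set: X] !=set0 ->
  (forall n x, exists2 y, E n x y & y <> x) ->
  exists f : cantor_space -> X, continuous f /\ bijective f.
Proof.
move=> uE cX [x0 _] pE; pose R : realType := Rdefinitions.R.
have : cantor_like (ultra_space uE x0).
  split => //; last 2 first.
  - exact: (ub_hausdorff uE).
  - exact: (ub_zero_dimensional uE).
  apply/perfectTP => x /(ub_openP uE)/(_ x erefl)[n En].
  by have [y /En yx] := pE n x.
move=> cantorX.
have [f [cf _]] :=
  @homeomorphism_cantor_like R (ultra_space uE x0) cantorX.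
by exists f; split => //; rewrite -setTT_bijective; exact: bij.
Qed.

Definition agree (T : Type) (n : nat) (x : nat -> T) : set (nat -> T) :=
  [set y | forall i, (i < n)%N -> x i = y i].

Lemma agree_ultra_base (T : discreteTopologicalType) :
  @ultra_base (prod_topology (fun _ : nat => T)) (@agree T).
Proof.
split=> [//|n x y xy i /xy//|n x y z xy yz i lti|m n x y mn xy i im|x y xy|].
- by rewrite xy ?yz.
- exact/xy/(leq_trans im).
- by apply/funext => i; exact: (xy i.+1).
move=> x A; split=> [xA|[n]].
  pose F : set_system (prod_topology (fun _ : nat => T)) :=
    filter_from [set: nat] (fun n => agree n x).
  have FF : Filter F.
    apply: filter_from_filter; first by exists 0%N.
    move=> i j _ _; exists (maxn i j) => // y xy.
    by split=> k kij; apply: xy; rewrite leq_max kij ?orbT.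
  (* The product topology is the supremum of the topologies pulled back along the coordinates, so
     convergence of [F] can be checked one coordinate at a time. *)
  suff /(_ A xA) [n _ nA] : F --> x by exists n.
  apply/cvg_sup => i B [_ [[C oC <-] Cx CB]].
  by exists i.+1 => // y xy; apply: CB; rewrite /= /proj -xy.
move/filterS; apply; elim: n => [|n IH].
  by apply: filterS filterT => y _ i.
have xn : nbhs (x : prod_topology (fun _ : nat => T)) [set y | y n = x n].
  exact: (@proj_continuous _ (fun _ : nat => T) n x _ (discrete_set1 (x n))).
apply: filterS2 IH xn => y xy xyn i; rewrite ltnS leq_eqVlt.
by move=> /predU1P[->//|/xy].
Qed.

Lemma ub_continuous (X Y : topologicalType) (E : nat -> X -> set X)
    (F : nat -> Y -> set Y) (f : X -> Y) : ultra_base E -> ultra_base F ->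
  (forall x n, exists m, forall y, E m x y -> F n (f x) (f y)) ->
  continuous f.
Proof.
move=> uE uF h x A /(ub_nbhs uF)[n nA]; apply/(ub_nbhs uE).
by have [m hm] := h x n; exists m => y /hm/nA.
Qed.

(** * Gluing sequences of isolated points to a Cantor space *)

Lemma ub_sep_finite (X : topologicalType) (E : nat -> X -> set X) (x : X)
    (A : set X) : ultra_base E -> finite_set A -> ~ A x ->
  exists n, forall y, A y -> ~ E n x y.
Proof.
move=> uE /finite_seqP[s ->]; elim: s => [|y s IH] /= nx; first by exists 0%N.
have [|n hn] := IH; first by move=> xs; apply: nx; rewrite inE xs orbT.
have [|m hm] := @ub_neq _ _ uE x y.
  by move=> xy; apply: nx; rewrite xy inE eqxx.
exists (maxn n m) => z; rewrite inE => /predU1P[->|zs] Ez.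
  by apply: hm; apply: (ub_mono uE) Ez; exact: leq_maxr.
by apply: (hn _ zs); apply: (ub_mono uE) Ez; exact: leq_maxl.
Qed.

Lemma cantor_ultra_base : @ultra_base cantor_space (@agree bool).
Proof. exact: agree_ultra_base. Qed.

(** In the group (Z/2)^N, translation by a + b exchanges [a] and [b] and preserves the union [P] of
    their classes of level [l]. With [l] so large that [P] avoids [A], apply it on the clopen set
    [P] and the identity elsewhere. *)
Lemma cantor_swap (a b : cantor_space) (A : set cantor_space) :
  finite_set A -> ~ A a -> ~ A b -> exists h : cantor_space -> cantor_space,
    [/\ continuous h, involutive h, h a = b & forall x, A x -> h x = x].
Proof.
move=> finA Aa Ab.
have [m hm] := ub_sep_finite cantor_ultra_base finA Aa.
have [n hn] := ub_sep_finite cantor_ultra_base finA Ab.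
pose l := maxn m n.
pose t (x : cantor_space) : cantor_space := fun i => x i (+) a i (+) b i.
pose P : set cantor_space := agree l a `|` agree l b.
pose h (x : cantor_space) := if `[< P x >] then t x else x.
have tK : involutive t.
  by move=> x; apply/funext => i; rewrite /t; case: (x i) (a i) (b i) => -[] [].
have Pt x : P x -> P (t x).
  move=> [xa|xb]; [right|left] => i il; rewrite /t -?(xa i il) -?(xb i il).
    by case: (a i) (b i) => -[].
  by case: (a i) (b i) => -[].
exists h; split.
- apply: (ub_continuous cantor_ultra_base cantor_ultra_base) => x d.
  exists (maxn l d) => y xy.
  have xyl : agree l x y.
    by apply: (ub_mono cantor_ultra_base) xy; exact: leq_maxl.
  have Pxy z : agree l z x <-> agree l z y.
    split=> h1; first exact: (ub_trans cantor_ultra_base) h1 xyl.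
    exact: (ub_trans cantor_ultra_base) h1 (ub_sym cantor_ultra_base xyl).
  have -> : h y = if `[< P x >] then t y else y.
    rewrite /h; suff -> : P y = P x by [].
    by apply/propext; split=> -[] /Pxy; [left|right|left|right].
  move=> i id; have xyi : x i = y i by apply: xy; rewrite leq_max id orbT.
  by rewrite /h; case: ifP => _; rewrite ?/t xyi.
- move=> x; rewrite {2}/h; case: asboolP => Px; rewrite /h.
    by rewrite asboolT ?tK//; exact: Pt.
  by rewrite asboolF.
- rewrite /h asboolT; last by left.
  by apply/funext => i; rewrite /t; case: (a i) (b i) => -[].
- move=> x Ax; rewrite /h asboolF// => -[xa|xb].
    by apply: (hm x Ax); apply: (ub_mono cantor_ultra_base) xa; exact: leq_maxl.
  by apply: (hn x Ax); apply: (ub_mono cantor_ultra_base) xb; exact: leq_maxr.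
Qed.

(** The points are placed one at a time: once the first [j] are right, a swap of [h (c j0)] with
    [x j0] fixes the earlier targets, which differ from both points by injectivity. *)
Lemma cantor_multitransitive (k : nat) (c x : 'I_k -> cantor_space) :
  injective c -> injective x -> exists h : cantor_space -> cantor_space,
    [/\ continuous h, bijective h & forall i, h (c i) = x i].
Proof.
move=> injc injx.
suff /(_ k) [h [ch bh hc]] : forall j : nat, exists h : cantor_space -> _,
    [/\ continuous h, bijective h & forall i : 'I_k, (i < j)%N -> h (c i) = x i].
  by exists h; split => // i; exact: hc.
elim=> [|j [h [ch bh hc]]].
  by exists id; split => //; [move=> z; exact: cvg_id|by exists id].
have [jk|kj] := ltnP j k; last first.
  by exists h; split => // i _; apply: hc; exact: leq_trans (ltn_ord i) kj.
pose j0 := Ordinal jk.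
have [|||s [cs ss s1 s2]] :=
    @cantor_swap (h (c j0)) (x j0) (x @` [set i : 'I_k | (i < j)%N]).
- exact/finite_image/finite_finset.
- move=> [i ij]; rewrite -hc// => /(bij_inj bh)/injc ij0.
  by move: ij; rewrite /= ij0 /= ltnn.
- by move=> [i ij] /injx ij0; move: ij; rewrite /= ij0 /= ltnn.
exists (s \o h); split.
- by move=> z; apply: continuous_comp; [exact: ch|exact: cs].
- by apply: bij_comp => //; exact: inv_bij.
move=> i; rewrite ltnS leq_eqVlt => /predU1P[ij|ij] /=.
  by have -> : i = j0 by exact: val_inj.
by rewrite hc//; apply: s2; exists i.
Qed.

Lemma set_type_compact (X : topologicalType) (A : set X) :
  compact A -> compact [set: set_type A].
Proof.
move=> cA F PF _.
have /cA[|x [Ax clx]] : ProperFilter ((\val : set_type A -> X) @ F).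
- exact: fmap_proper_filter.
- by apply: (@filterS _ F _ setT) => [y _|]; [exact: set_valP|exact: filterT].
exists (exist _ x (mem_set Ax)); split => // U V FU [_ [[W oW <-] Wx WV]].
have [y [[z Uz <-] Wz]] : ((\val : set_type A -> X) @` U) `&` W !=set0.
  apply: clx; last exact: open_nbhs_nbhs.
  by apply: (@filterS _ F _ U) => // z Uz; exists z.
by exists z; split => //; exact: WV.
Qed.

Section Gluing.
Variables (k : nat) (c : 'I_k -> cantor_space).

Lemma glue_map_continuous : continuous (glue_map c : disj_union k -> glued k c).
Proof. by apply/continuousP => U. Qed.

Lemma glued_compact : compact [set: glued k c].
Proof.
have -> : [set: glued k c] = glue_map c @` [set: disj_union k].
  apply/seteqP; split=> // -[x|[i n]] _.
    by exists (existT _ true x).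
  by exists (existT (glue_fam k) false (existT _ i (Some n))).
apply: continuous_compact.
  exact/continuous_subspaceT/glue_map_continuous.
apply: sigT_compact; first exact: finite_finset.
move=> [|]; first exact: cantor_space_compact.
apply: sigT_compact; first exact: finite_finset.
by move=> _; exact: one_point_compactification_compact.
Qed.

(** The finiteness hypothesis is convergence of [psi i] to [phi (c i)]: neighbourhoods of infinity
    in the one-point compactification are complements of compact, hence finite, sets of naturals. *)
Lemma glued_continuous (X : topologicalType) (phi : cantor_space -> X)
    (psi : 'I_k -> nat -> X) :
  continuous phi ->
  (forall i (U : set X), open U -> U (phi (c i)) ->
     finite_set [set n | ~ U (psi i n)]) ->
  continuous (fun z : glued k c =>
    match z with inl x => phi x | inr (i, n) => psi i n end).
Proof.
move=> cphi fpsi; apply/continuousP => U oU; rewrite /open /= /glued_open.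
apply/sigT_openP => -[|]; first by move/continuousP: cphi; exact.
apply/sigT_openP => i; rewrite openE => -[n Un|/= Ui].
  exact: (@open_nbhs_nbhs nat n) (conj (discrete_open _) Un).
exists [set n | ~ U (psi i n)].
  by split; [exact/finite_compact/fpsi|exact: discrete_closed].
by move=> _ [[n /contrapT Un <-]|->].
Qed.

End Gluing.

(** * Compact spaces made of a perfect set and isolated points accumulating at finitely many
    places *)

Section Classification.
Variables (X : topologicalType) (E : nat -> X -> set X) (k : nat).
Variables (K : set X) (v : 'I_k -> X).
Hypotheses (uE : ultra_base E) (cX : compact [set: X]) (k_gt0 : (0 < k)%N).
Hypothesis isolatedCK : forall x, ~ K x -> open [set x].
Hypothesis perfectK : forall n x, K x -> exists y, [/\ K y, E n x y & y <> x].
Hypotheses (Kv : forall i, K (v i)) (inj_v : injective v).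
Hypothesis accCK : forall x, K x ->
  (forall n, exists2 y, ~ K y & E n x y) -> exists i, x = v i.
Hypothesis accv : forall i n, exists2 y, ~ K y & E n (v i) y.

(** An accumulation point of this set would lie in [K], as points off [K] are isolated, hence be
    some [v i], whose class of level [n] the set avoids. *)
Lemma finite_far n : finite_set [set y | ~ K y /\ forall i, ~ E n (v i) y].
Proof.
apply: contrapT => /(ub_accumulation uE cX)[x hx].
have Kx : K x.
  apply: contrapT => /isolatedCK/(ub_openP uE)/(_ x erefl)[m Em].
  by have [y [_ /Em]] := hx m.
have [|i xi] := accCK Kx; first by move=> m; have [y [[]]] := hx m; exists y.
by have [y [[_ /(_ i)]]] := hx n; rewrite xi.
Qed.

Lemma separating_level : exists n, forall i j, E n (v i) (v j) -> i = j.
Proof.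
have /choice[r hr] : forall i, exists n, forall j, E n (v i) (v j) -> i = j.
  move=> i; have [||n hn] := @ub_sep_finite _ _ (v i) (v @` [set~ i]) uE.
  - exact/finite_image/finite_finset.
  - by move=> [j ji /inj_v].
  exists n => j Ej; apply: contrapT => ij; apply: (hn (v j)) => //.
  by exists j => // ji; apply: ij.
exists (\max_i r i)%N => i j Eij; apply: (hr i).
by apply: (ub_mono uE) Eij; exact: leq_bigmax.
Qed.

Lemma isolated_enumeration : exists psi : 'I_k -> nat -> X,
  [/\ forall i n, ~ K (psi i n),
      forall y, ~ K y -> exists i n, y = psi i n,
      forall i j m n, psi i m = psi j n -> i = j /\ m = n &
      forall i n, finite_set [set m | ~ E n (v i) (psi i m)]].
Proof.
have [M hM] := separating_level.
have /choice[r hr] : forall y, exists i : 'I_k, forall j, E M (v j) y -> j = i.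
  move=> y; have [[i Ei]|nE] := pselect (exists i, E M (v i) y); last first.
    (* Points close to no [v i] go to a default index; only finitely many points off [K] are
       concerned, so convergence is not affected. *)
    by exists (Ordinal k_gt0) => j Ej; case: nE; exists j.
  by exists i => j Ej; apply/hM/(ub_trans uE Ej)/(ub_sym uE).
pose J i := [set y | ~ K y /\ r y = i].
have finJ i n : finite_set (J i `&` [set y | ~ E n (v i) y]).
  apply: sub_finite_set (finite_far (maxn n M)) => y [[Ky ry] nEy].
  split => // j Ej; apply: nEy.
  have <- : j = i.
    by rewrite -ry; apply: hr; apply: (ub_mono uE) Ej; exact: leq_maxr.
  by apply: (ub_mono uE) Ej; exact: leq_maxl.
(* A finite [J i] would be separated from [v i] by some level, against [accv]. *)
have infJ i : infinite_set (J i).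
  move=> /(@ub_sep_finite _ _ (v i) _ uE)[|n hn]; first by case=> /(_ (Kv i)).
  have [y Ky Ey] := accv i (maxn n M).
  apply: (hn y); last by apply: (ub_mono uE) Ey; exact: leq_maxl.
  split => //; apply/esym/hr; apply: (ub_mono uE) Ey; exact: leq_maxr.
have /choice[psi hpsi] : forall i, exists f : nat -> X,
    [/\ injective f, forall n, J i (f n) & forall y, J i y -> exists n, y = f n].
  move=> i; have /card_set_bijP[f [_ injf surjf]] : (J i #= [set: nat])%card.
    apply: eq_card_nat (infJ i).
    apply: (ub_countable_isolated uE cX) => x [Kx _]; exact: isolatedCK.
  have /choice[g hg] : forall n, exists x, J i x /\ f x = n.
    by move=> n; have [x Jx <-] := surjf n I; exists x.
  exists g; split.
  - by move=> m n gmn; rewrite -(hg m).2 gmn (hg n).2.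
  - by move=> n; exact: (hg n).1.
  - move=> y Jy; exists (f y); apply: injf; rewrite ?inE ?(hg _).2//.
    exact: (hg _).1.
exists psi; split.
- by move=> i n; have [_ /(_ n)[]] := hpsi i.
- by move=> y Ky; have [_ _ /(_ y)[//|n yn]] := hpsi (r y); exists (r y), n.
- move=> i j m n ij.
  have eij : i = j.
    have [_ /(_ m)[_ <-] _] := hpsi i; have [_ /(_ n)[_ <-] _] := hpsi j.
    by rewrite ij.
  by split=> //; have [+ _ _] := hpsi i; apply; rewrite ij eij.
- move=> i n; have [injf fJ _] := hpsi i.
  apply: (@sub_finite_set _ _ (psi i @^-1` (J i `&` [set y | ~ E n (v i) y]))).
    by move=> m /= nE; split=> //; exact: fJ.
  by apply: finite_preimage (finJ i n) => a b _ _; exact: injf.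
Qed.

Lemma homeomorphic_glued (c : 'I_k -> cantor_space) :
  injective c -> homeomorphic X (glued k c).
Proof.
move=> injc.
have closedK : closed K.
  rewrite -openC; apply/(ub_openP uE) => x Kx.
  have /(ub_openP uE)/(_ x erefl)[n hn] := isolatedCK Kx.
  by exists n => y /hn ->.
have cK : compact [set: set_type K].
  by apply: set_type_compact; exact: subclosed_compact cX _.
have [|n x|f0 [cf0 [g0 f0K g0K]]] := cantor_parametrization (ub_set_type uE K) cK.
- by exists (exist _ (v (Ordinal k_gt0)) (mem_set (Kv _))).
- have [y [Ky Ey yx]] := perfectK n (set_valP x).
  by exists (exist _ y (mem_set Ky)) => //= yx'; apply: yx; rewrite -yx'.
pose x i := g0 (exist _ (v i) (mem_set (Kv i))).
have injx : injective x.
  by move=> i j /(can_inj g0K)/(congr1 val)/inj_v.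
(* The parametrization [f0] takes the value [v i] at an uncontrolled point [x i], while the gluing
   points [c i] are prescribed; [h] moves the latter to the former. *)
have [h [ch [h' hK h'K] hc]] := cantor_multitransitive injc injx.
pose phi z : X := val (f0 (h z)).
have cphi : continuous phi.
  move=> z; apply: continuous_comp; last exact: initial_continuous.
  by apply: continuous_comp; [exact: ch|exact: cf0].
have phic i : phi (c i) = v i by rewrite /phi hc g0K.
have injphi : injective phi.
  by move=> a b /val_inj/(can_inj f0K)/(can_inj hK).
have Kphi z : K (phi z) by exact: set_valP.
have [psi [nKpsi surjpsi injpsi finpsi]] := isolated_enumeration.
pose f (z : glued k c) : X :=
  match z with inl x => phi x | inr (i, n) => psi i n end.
have cf : continuous f.
  apply: glued_continuous => // i U /(ub_openP uE) oU; rewrite phic => /oU[n nU].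
  by apply: sub_finite_set (finpsi i n) => m /= nUm Em; exact/nUm/nU.
have injf : injective f.
  move=> [a|[i m]] [b|[j n]] /= eab.
  - by rewrite (injphi _ _ eab).
  - by case: (nKpsi j n); rewrite -eab.
  - by case: (nKpsi i m); rewrite eab.
  - by have [-> ->] := injpsi _ _ _ _ eab.
have /choice[g gK] : forall y, exists z, f z = y.
  move=> y; have [Ky|/surjpsi[i [n ->]]] := pselect (K y); last first.
    by exists (inr (i, n)).
  exists (inl (h' (g0 (exist _ y (mem_set Ky))))).
  by rewrite /= /phi h'K g0K.
exists g, f; split => //; first by move=> z; apply: injf; rewrite gK.
(* A closed subset of the compact glued space has a compact, hence closed, image under [f]; this is
   continuity of the inverse. *)
apply/continuous_closedP => A clA.
have -> : g @^-1` A = f @` A.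
  apply/seteqP; split=> [y Ay|_ [z Az <-]]; first by exists (g y).
  by rewrite /preimage /= (_ : g (f z) = z)//; apply: injf; rewrite gK.
apply: (compact_closed (ub_hausdorff uE)); apply: continuous_compact.
  exact: continuous_subspaceT.
by apply: (subclosed_compact clA (@glued_compact _ c)).
Qed.


End Classification.

(** * The Chabauty topology *)

Lemma filter_all_seq (T : Type) (I : eqType) (F : set_system T) (s : seq I)
    (P : I -> set T) : Filter F ->
  (forall i, i \in s -> F (P i)) -> F [set x | forall i, i \in s -> P i x].
Proof.
move=> FF; elim: s => [|i s IH] Fs; first by apply: filterS filterT.
have Fi : F (P i) by apply: Fs; rewrite inE eqxx.
have {IH}Fs' : F [set x | forall i, i \in s -> P i x].
  by apply: IH => j js; apply: Fs; rewrite inE js orbT.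
by apply: filterS2 Fi Fs' => x Pi Ps j; rewrite inE => /predU1P[->|/Ps].
Qed.

Lemma chabauty_subbasic_open (X : topologicalType) (i : set X * bool) :
  chabauty_index i -> open (chabauty_subbasic i : set (chabauty X)).
Proof.
move=> hi; exists [set chabauty_subbasic i]; last by rewrite bigcup_set1.
by move=> _ ->; exact: finI_from1.
Qed.

Lemma chabauty_nbhsP (X : topologicalType) (H : chabauty X) (V : set (chabauty X)) :
  nbhs H V -> exists s : seq (set X * bool),
    (forall i, i \in s -> chabauty_index i /\ chabauty_subbasic i H) /\
    forall H', (forall i, i \in s -> chabauty_subbasic i H') -> V H'.
Proof.
rewrite nbhsE => -[_ [[B sB <-] [C BC CH] BV]].
have [D sD eqC] := sB _ BC; exists (enum_fset D); split=> [i iD|H' H'D].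
  split; first exact/set_mem/sD.
  by move: CH; rewrite -eqC; apply.
have CH' : C H' by rewrite -eqC => i iD; exact: H'D.
by apply: BV; exists C.
Qed.

Section ChabautyBase.
Variables (X : topologicalType) (E : nat -> X -> set X) (F : nat -> set X).
Hypothesis uE : ultra_base E.
Hypothesis cF : forall n, compact (F n).
Hypothesis leF : forall m n, (m <= n)%N -> F m `<=` F n.
Hypothesis covF : forall x, exists n, F n x.
Hypothesis satF : forall m n x y, F n x -> E m x y -> F n y.

Definition hits n (H : set X) (x : X) := exists2 h, H h & E n x h.

(** A discretized Chabauty neighbourhood: compactness of [F n] reduces the condition to finitely
    many classes of level [n], each either hit or missed. *)
Definition chabauty_near n (H : set X) : set (set X) :=
  [set H' | forall x, F n x -> hits n H x <-> hits n H' x].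

Lemma hits_refl n (H : set X) x : H x -> hits n H x.
Proof. by move=> Hx; exists x => //; exact: (ub_refl uE). Qed.

Lemma hits_trans n (H : set X) x y : E n x y -> hits n H y -> hits n H x.
Proof. by move=> xy [z Hz yz]; exists z => //; exact: (ub_trans uE) xy yz. Qed.

Lemma hits_le m n (H : set X) x : (m <= n)%N -> hits n H x -> hits m H x.
Proof. by move=> mn [z Hz xz]; exists z => //; exact: (ub_mono uE) xz. Qed.

Lemma closed_hitsP (H : set X) :
  closed H <-> forall x, (forall n, hits n H x) -> H x.
Proof.
split=> [cH x hx|h].
  apply: cH => B /(ub_nbhs uE)[n nB]; have [z Hz xz] := hx n.
  by exists z; split=> //; exact: nB.
move=> x clx; apply: h => n; have [z [Hz Ez]] := clx _ (ub_nbhsE uE n x).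
by exists z.
Qed.

(** A witness [h] in the coarse class of [x] remains in [F m], since [F] is saturated for classes of
    every level; the fine class of [h] then transfers it to the other set. *)
Lemma chabauty_near_le m n H H' :
  (m <= n)%N -> chabauty_near n H H' -> chabauty_near m H H'.
Proof.
move=> mn HH' x Fx; split=> -[h Hh xh].
  have Fh : F n h by apply/(leF mn)/(satF Fx xh).
  have := (HH' h Fh).1 (hits_refl n Hh).
  by move/(hits_le mn); exact: hits_trans.
have Fh : F n h by apply/(leF mn)/(satF Fx xh).
have := (HH' h Fh).2 (hits_refl n Hh).
by move/(hits_le mn); exact: hits_trans.
Qed.

Lemma compact_class n y : compact (F n `&` E n y).
Proof.
apply: (@subclosed_compact _ (F n `&` E n y) (F n)); [|exact: cF|by move=> z []].
apply: closedI; last by have [] := ub_clopen uE n y.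
exact: compact_closed (ub_hausdorff uE) (@cF n).
Qed.

Lemma chabauty_near_finite n : exists s : seq X,
  (forall y, y \in s -> F n y) /\
  forall H H', (forall y, y \in s -> hits n H y <-> hits n H' y) ->
    chabauty_near n H H'.
Proof.
have [s [sF hs]] := ub_finite_cover uE (fun=> n) (@cF n).
exists s; split => // H H' HH' x /hs[y /HH' ys Eyx].
have Exy := ub_sym uE Eyx.
by split=> /(hits_trans Eyx)/ys/(hits_trans Exy).
Qed.

Section Subspace.
Variable A : set (chabauty X).
Hypothesis clA : A `<=` @closed_sets X.

(** To miss a compact set: each of its points has a class missed by the closed set [H], and finitely
    many such classes cover. To hit an open set: one class around a common point suffices. In both
    cases the level is also raised until the points involved lie in [F]. *)
Lemma chabauty_near_subbasic (H : set X) i : closed H ->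
  chabauty_index i -> chabauty_subbasic i H ->
  exists n, forall H', closed H' -> chabauty_near n H H' -> chabauty_subbasic i H'.
Proof.
move=> cH; case: i => U [] /=; rewrite /chabauty_index /chabauty_subbasic /=.
  move=> cU HU.
  have /choice[r hr] : forall x, exists n, U x -> F n x /\ ~ hits n H x.
    move=> x; have [Ux|] := pselect (U x); last by exists 0%N.
    have /existsNP[m hm] : ~ forall n, hits n H x.
      move=> /((closed_hitsP H).1 cH) Hx.
      by have : (H `&` U) x by []; rewrite HU.
    have [n Fn] := covF x; exists (maxn m n) => _; split.
      exact: leF (leq_maxr _ _) _ Fn.
    by move/(hits_le (leq_maxl _ _)).
  have [s [sU hs]] := ub_finite_cover uE r cU.
  exists (\max_(y <- s) r y)%N => H' cH' HH'; apply/seteqP; split => // x [H'x].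
  move=> /hs[y ys Eyx]; have [Fy nHy] := hr y (sU y ys); case: nHy.
  have rs : (r y <= \max_(y <- s) r y)%N by exact: leq_bigmax_seq.
  apply: ((chabauty_near_le rs HH') y Fy).2.
  by exists x.
move=> oU [x [Hx /((ub_openP uE U).1 oU)[m mU]]].
have [n Fn] := covF x; exists (maxn m n) => H' cH' /(_ x) HH'.
have [||h H'h xh] := (HH' _).1; first exact: leF (leq_maxr _ _) _ Fn.
  exact: hits_refl.
by exists h; split => //; apply/mU/(ub_mono uE _ xh)/leq_maxl.
Qed.

Lemma chabauty_ultra_base : @ultra_base (set_type A)
  (fun n H H' => chabauty_near n (val H) (val H')).
Proof.
split=> [n H x _|n H H' h x Fx|n H H1 H2 h1 h2 x Fx|m n H H'|H H' h|].
- by [].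
- by apply: iff_sym; exact: h.
- by apply: iff_trans (h1 x Fx) (h2 x Fx).
- exact: chabauty_near_le.
- have sub (H1 H2 : set_type A) :
      (forall n, chabauty_near n (val H1) (val H2)) -> val H1 `<=` val H2.
    move=> {}h x H1x; have /clA/closed_hitsP := set_valP H2; apply=> m.
    have [n Fn] := covF x.
    apply: (hits_le (leq_maxl m n)).
    apply: (h (maxn m n) x _).1; first exact: leF (leq_maxr _ _) _ Fn.
    exact: hits_refl.
  apply/val_inj/seteqP; split; first exact: sub.
  by apply: sub => n x Fx; apply: iff_sym; exact: h.
move=> H W; split=> [[_ [[V oV <-] VH VW]]|[n nW]].
  have /chabauty_nbhsP[s [sH sV]] : nbhs (val H : chabauty X) V.
    by apply: open_nbhs_nbhs.
  have cH : closed (val H : set X) := clA (set_valP H).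
  have /choice[r hr] : forall i, exists n, i \in s -> forall H', closed H' ->
      chabauty_near n (val H) H' -> chabauty_subbasic i H'.
    move=> i; have [|_] := boolP (i \in s); last by exists 0%N.
    by move=> /sH[i1 i2]; have [n hn] := chabauty_near_subbasic cH i1 i2; exists n.
  exists (\max_(i <- s) r i)%N => H' HH'; apply/VW/sV => i si; apply: (hr i si).
    exact: clA (set_valP H').
  by apply: chabauty_near_le HH'; exact: leq_bigmax_seq.
have [s [sF sn]] := chabauty_near_finite n.
suff /filterS : nbhs H [set H' : set_type A |
    forall y, y \in s -> hits n (val H) y <-> hits n (val H') y].
  by apply => H' HH'; exact/nW/sn.
apply: (@filter_all_seq _ _ (nbhs H) s
  (fun y => [set H' : set_type A | hits n (val H) y <-> hits n (val H') y])).
move=> y /sF Fy; have [[h Hh yh]|nHy] := pselect (hits n (val H) y).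
  have oV : open (chabauty_subbasic (E n y, false) : set (chabauty X)).
    by apply: chabauty_subbasic_open; exact: ub_open.
  exists (val @^-1` chabauty_subbasic (E n y, false)).
    split; first by exists (chabauty_subbasic (E n y, false)).
    by exists h.
  by move=> H' [h' [H'h' yh']]; split => _; [exists h'|exists h].
(* Missing a set is an open condition only for compact sets, hence the intersection with [F n]. It
   loses nothing: [F n] is saturated and contains [y]. *)
have oV : open (chabauty_subbasic (F n `&` E n y, true) : set (chabauty X)).
  by apply: chabauty_subbasic_open; exact: compact_class.
exists (val @^-1` chabauty_subbasic (F n `&` E n y, true)).
  split; first by exists (chabauty_subbasic (F n `&` E n y, true)).
  by apply/seteqP; split=> // h [Hh [_ yh]]; apply: nHy; exists h.
move=> H' /= eH'; split=> // -[h H'h yh].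
have : (val H' `&` (F n `&` E n y)) h by split=> //; split=> //; exact: satF Fy yh.
by rewrite /preimage /= in eH'; rewrite eH'.
Qed.

(** The lower limit of the sets along [G]; for an ultrafilter it is the Chabauty limit. *)
Definition hits_lim (G : set_system (set_type A)) : set X :=
  [set x | forall n, G [set H | hits n (val H) x]].

Lemma hits_lim_closed (G : set_system (set_type A)) :
  Filter G -> closed (hits_lim G).
Proof.
move=> FG; apply/closed_hitsP => x hx n; have [y /(_ n) Gy xy] := hx n.
by apply: filterS Gy => H; exact: hits_trans.
Qed.

Lemma chabauty_compact :
  (forall G, UltraFilter G -> A (hits_lim G)) -> compact [set: set_type A].
Proof.
move=> Alim; rewrite compact_ultra => G UG _.
have PG : ProperFilter G := @ultra_proper _ _ UG.
exists (exist _ (hits_lim G) (mem_set (Alim _ UG))); split => // W.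
move=> /(ub_nbhs chabauty_ultra_base)[n nW].
have [s [sF sn]] := chabauty_near_finite n.
suff : G [set H : set_type A |
    forall y, y \in s -> hits n (hits_lim G) y <-> hits n (val H) y].
  by apply: filterS => H HH; apply/nW/sn.
apply: (@filter_all_seq _ _ G s (fun y =>
  [set H : set_type A | hits n (hits_lim G) y <-> hits n (val H) y])).
move=> y /sF Fy; have [[h Gh yh]|nGy] := pselect (hits n (hits_lim G) y).
  apply: filterS (Gh n) => H hH; split=> _; last by exists h.
  exact: hits_trans hH.
have [Gy|] := in_ultra_setVsetC [set H | hits n (val H) y] UG; last first.
  by apply: filterS => H nH; split.
(* Suppose that [G]-almost all sets hit the class of [y] while the limit misses it. Each point of
   this compact class then has a smaller class missed by [G]-almost all sets, and a finite cover by
   these gives a contradiction. *)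
have /choice[r hr] : forall x, exists m, (F n `&` E n y) x ->
    G [set H | ~ hits m (val H) x].
  move=> x; have [[Fx yx]|] := pselect ((F n `&` E n y) x); last by exists 0%N.
  have /existsNP[m hm] : ~ hits_lim G x by move=> Gx; apply: nGy; exists x.
  by exists m => _; have [//|] := in_ultra_setVsetC [set H | hits m (val H) x] UG.
have [t [tB tcov]] := ub_finite_cover uE r (@compact_class n y).
have Gt : G [set H | forall z, z \in t -> ~ hits (r z) (val H) z].
  apply: (@filter_all_seq _ _ G t (fun z => [set H | ~ hits (r z) (val H) z])).
  by move=> z /tB/hr.
have [H [[h Hh yh] nH]] := filter_ex (filterI Gy Gt).
have [|z zt zh] := tcov h; first by split => //; exact: satF Fy yh.
by case: (nH z zt); exists h.
Qed.

End Subspace.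
End ChabautyBase.

(** * The group of p-adic units *)

Lemma modn_inv_unique (d x a b : nat) :
  a * x = 1 %[mod d] -> b * x = 1 %[mod d] -> a = b %[mod d].
Proof.
move=> ax bx; rewrite -[a]muln1 -modnMmr -bx modnMmr mulnCA -modnMmr ax modnMmr.
by rewrite muln1.
Qed.

Lemma binomial_expansion1 (t e : nat) :
  exists r, ((1 + t) ^ e = 1 + e * t + t ^ 2 * r)%N.
Proof.
elim: e => [|e [r IH]]; first by exists 0%N; rewrite muln0.
by exists (e + (1 + t) * r)%N; rewrite expnS IH; ring.
Qed.

Lemma binomial_expansion2 (t e : nat) :
  exists r, ((1 + t) ^ e = 1 + e * t + 'C(e, 2) * t ^ 2 + t ^ 3 * r)%N.
Proof.
elim: e => [|e [r IH]]; first by exists 0%N; rewrite !muln0.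
exists ('C(e, 2) + (1 + t) * r)%N; rewrite expnS IH binS bin1; ring.
Qed.

(** The primality proof is a parameter of the alias, so that it is available to the group structure
    attached below. *)
Definition zunits (p : nat) (pr : prime p) : Type := Zpu p.

Section PadicUnits.
Variables (p : nat) (pr : prime p).
Local Notation U := (zunits pr).

Let p_gt0 : (0 < p)%N := prime_gt0 pr.
Let p_gt1 : (1 < p)%N := prime_gt1 pr.

(* The least level from which the p-power map raises levels by exactly one. *)
Definition unit_modulus := if odd p then 1%N else 2%N.

(** With t = p^n w, the terms after 1 + p t must be divisible by p^(n+2). The cubic remainder is, as
    soon as n is at least 1. The quadratic term gains a factor p from the binomial coefficient when
    p is odd; for p = 2 this coefficient is 1 and 2n must reach n + 2, whence the modulus 4. *)
Lemma expnD1_lift (n w : nat) : (unit_modulus <= n)%N ->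
  exists s, ((1 + p ^ n * w) ^ p = 1 + p ^ n.+1 * (w + p * s))%N.
Proof.
have [r ->] := binomial_expansion2 (p ^ n * w) p.
rewrite /unit_modulus; case: ifP => [oddp n0|/negbT/(prime_oddPn pr) p2].
  have /dvdnP[b ->] : (p %| 'C(p, 2))%N.
    by apply: prime_dvd_bin => //; rewrite /= ltn_neqAle p_gt1 andbT;
      apply: contraTneq oddp => <-.
  case: n n0 => // n _.
  exists (b * p ^ n * w ^ 2 + p ^ n * p ^ n * w ^ 3 * r)%N.
  rewrite !expnS; ring.
case: n => [|[|n]] // _; rewrite p2.
exists (2 ^ n * w ^ 2 + 2 ^ n * 2 ^ n * 4 * w ^ 3 * r)%N.
rewrite binn !expnS; ring.
Qed.

Lemma modn_mod_exp m n a : (m <= n)%N -> a %% p ^ n = a %[mod p ^ m].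
Proof. by move=> mn; apply: modn_dvdm; exact: dvdn_exp2l. Qed.

HB.instance Definition _ := Choice.copy U (Zpu p).

Definition res (x : U) : nat -> nat := val (x : Zpu p).

Lemma res_lt x n : (res x n < p ^ n)%N.
Proof. by case: x => x hx; have [/(_ n)[]] := set_mem hx. Qed.

Lemma res_le x m n : (m <= n)%N -> res x n = res x m %[mod p ^ m].
Proof.
elim: n => [|n IH]; first by rewrite leqn0 => /eqP ->.
rewrite leq_eqVlt => /predU1P[->//|mn]; rewrite -IH//.
have <- : res x n.+1 %% p ^ n = res x n.
  by case: x {IH} => x hx; have [/(_ n)[]] := set_mem hx.
by rewrite modn_mod_exp.
Qed.

Lemma res_mod x n : res x n %% p ^ n = res x n.
Proof. by rewrite modn_small ?res_lt. Qed.

Lemma res_modE x m n : (m <= n)%N -> res x n %% p ^ m = res x m.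
Proof. by move=> mn; rewrite res_le// res_mod. Qed.

Lemma coprime_res1 x : coprime (res x 1) p.
Proof. by case: x => x hx; have [] := set_mem hx. Qed.

Lemma coprime_res x n : coprime (res x n) (p ^ n).
Proof.
case: n => [|n]; first by rewrite expn0 coprimen1.
rewrite coprimeXr// -coprime_modl -[X in _ %% X]expn1 res_modE//.
exact: coprime_res1.
Qed.

Lemma res_inj x y : (forall n, res x n = res y n) -> x = y.
Proof. by move=> xy; apply: val_inj; apply/funext. Qed.

Section MakeUnit.
Variable f : nat -> nat.
Hypotheses (f_compat : forall n, f n.+1 = f n %[mod p ^ n]).
Hypothesis f_unit : coprime (f 1) p.

Lemma mk_unit_subproof : (fun n => f n %% p ^ n)%N \in zpu_set p.
Proof.
apply/mem_set; split=> [n|]; last by rewrite expn1 coprime_modl.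
by rewrite ltn_pmod ?expn_gt0 ?p_gt0// modn_mod_exp.
Qed.

Definition mk_unit : U :=
  exist (fun x => x \in zpu_set p) _ mk_unit_subproof.

Lemma res_mk n : res mk_unit n = f n %% p ^ n. Proof. by []. Qed.

End MakeUnit.

Lemma coprime_one_plus n : (0 < n)%N -> coprime (1 + p ^ n) p.
Proof.
by case: n => // n _; rewrite expnS -coprime_modl addnC mulnC modnMDl
  coprime_modl coprime1n.
Qed.

Definition uone : U :=
  @mk_unit (fun=> 1%N) (fun=> erefl) (coprime1n p).

(** The inverse modulo p^n given by Euler's theorem; compatibility between levels follows from
    uniqueness of inverses. *)
Let inv_fun (x : U) n := (res x n ^ (totient (p ^ n)).-1)%N.

Lemma inv_funP x n : inv_fun x n * res x n = 1 %[mod p ^ n].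
Proof.
rewrite mulnC -expnS prednK; first exact: Euler_exp_totient (coprime_res x n).
by rewrite totient_gt0 expn_gt0 p_gt0.
Qed.

Lemma inv_fun_compat x n : inv_fun x n.+1 = inv_fun x n %[mod p ^ n].
Proof.
apply: (@modn_inv_unique _ (res x n)); last exact: inv_funP.
rewrite -modnMmr -(res_modE x (leqnSn n)) modn_mod modnMmr.
by rewrite -(modn_mod_exp _ (leqnSn n)) inv_funP modn_mod_exp.
Qed.

Lemma inv_fun_unit x : coprime (inv_fun x 1) p.
Proof. by rewrite coprimeXl ?coprime_res1. Qed.

Definition uinv x : U := mk_unit (inv_fun_compat x) (inv_fun_unit x).
Definition umul (x y : U) : U := zpu_mul x y.

Lemma res_mul x y n : res (umul x y) n = (res x n * res y n) %% p ^ n.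
Proof. by []. Qed.

Fact umulA : associative umul.
Proof.
by move=> x y z; apply: res_inj => n; rewrite !res_mul modnMmr modnMml mulnA.
Qed.

Fact umulC : commutative umul.
Proof. by move=> x y; apply: res_inj => n; rewrite !res_mul mulnC. Qed.

Fact umul1 : left_id uone umul.
Proof.
by move=> x; apply: res_inj => n; rewrite res_mul res_mk modnMml mul1n res_mod.
Qed.

Fact umulV : left_inverse uone uinv umul.
Proof.
by move=> x; apply: res_inj => n; rewrite res_mul !res_mk modnMml inv_funP.
Qed.

(* The multiplicative group of p-adic units, written additively. *)
HB.instance Definition _ :=
  GRing.isZmodule.Build U umulA umulC umul1 umulV.

End PadicUnits.

(** * Filtration of the units by congruence to 1 *)

Section PadicUnits2.
Variables (p : nat) (pr : prime p).
Local Notation U := (zunits pr).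
Local Notation q := (unit_modulus p).
Implicit Types (x y z : U) (V : set U).

Let p_gt0 : (0 < p)%N := prime_gt0 pr.
Let p_gt1 : (1 < p)%N := prime_gt1 pr.

Lemma unit_modulus_gt0 : (0 < q)%N.
Proof. by rewrite /unit_modulus; case: ifP. Qed.

Lemma resD x y n : res (x + y)%R n = (res x n * res y n) %% p ^ n.
Proof. by []. Qed.

Lemma res0 n : res (0%R : U) n = 1 %% p ^ n.
Proof. by []. Qed.

Lemma res0S n : (0 < n)%N -> res (0%R : U) n = 1%N.
Proof.
by move=> n0; rewrite res0 modn_small// -{1}(expn0 p) ltn_exp2l.
Qed.

Lemma resMn x e n : res (x *+ e)%R n = res x n ^ e %% p ^ n.
Proof.
elim: e => [|e IH]; first by rewrite mulr0n res0.
by rewrite mulrS resD IH modnMmr expnS.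
Qed.

Lemma eq_resD x x' y y' n : res x n = res x' n -> res y n = res y' n ->
  res (x + y)%R n = res (x' + y')%R n.
Proof. by move=> xx yy; rewrite !resD xx yy. Qed.

Lemma eq_resN x y n : res x n = res y n -> res (- x)%R n = res (- y)%R n.
Proof.
move=> xy; have h z : res (- z)%R n * res z n = 1 %[mod p ^ n].
  by rewrite -resD addNr res0.
rewrite -[LHS]res_mod -[RHS]res_mod; apply: (@modn_inv_unique _ (res x n)) => //.
by rewrite xy.
Qed.

Lemma eq_resB x x' y y' n : res x n = res x' n -> res y n = res y' n ->
  res (x - y)%R n = res (x' - y')%R n.
Proof. by move=> xx yy; apply: eq_resD => //; exact: eq_resN. Qed.

Lemma eq_resMn x y e n : res x n = res y n -> res (x *+ e)%R n = res (y *+ e)%R n.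
Proof. by move=> xy; rewrite !resMn xy. Qed.

Lemma eq_res_le x y m n : (m <= n)%N -> res x n = res y n -> res x m = res y m.
Proof. by move=> mn xy; rewrite -(res_modE x mn) xy res_modE. Qed.

(** Membership in 1 + p^n Z_p, the neutral element being written 0. *)
Definition level n x := res x n = res (0%R : U) n.

Lemma eq_res_level x y n : res x n = res y n <-> level n (x - y)%R.
Proof.
rewrite /level; split=> [xy|xy].
  by rewrite -(subrr y); exact: eq_resB.
by rewrite -[x](subrK y) -[in RHS](add0r y); exact: eq_resD.
Qed.

Lemma level_le m n x : (m <= n)%N -> level n x -> level m x.
Proof. exact: eq_res_le. Qed.

Lemma level_inj x : (forall n, level n x) -> x = 0%R.
Proof. by move=> h; apply: res_inj. Qed.

Lemma level_expansion m n x : (0 < m <= n)%N -> level m x ->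
  exists w, res x n = (1 + p ^ m * w)%N.
Proof.
case/andP=> m0 mn xm; exists (res x n %/ p ^ m).
by rewrite [LHS](divn_eq _ (p ^ m)) res_modE// xm res0S// addnC mulnC.
Qed.

Lemma expansion_level m x w : (0 < m)%N ->
  res x m.+1 = (1 + p ^ m * w) %% p ^ m.+1 -> level m x /\ (level m.+1 x <-> p %| w).
Proof.
move=> m0 xw; split.
  rewrite /level -(res_modE x (leqnSn m)) xw modn_mod_exp// addnC mulnC modnMDl.
  by rewrite res0.
rewrite /level xw res0; split.
  move/eqP; rewrite eqn_mod_dvd ?leq_addr// addKn expnSr dvdn_pmul2l//.
  by rewrite expn_gt0 p_gt0.
move=> pw; apply/eqP; rewrite eqn_mod_dvd ?leq_addr// addKn expnSr.
by rewrite dvdn_pmul2l// expn_gt0 p_gt0.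
Qed.

Definition exact_level n x := level n x /\ ~ level n.+1 x.

Lemma exact_levelX n x : (q <= n)%N -> exact_level n x ->
  exact_level n.+1 (x *+ p)%R.
Proof.
move=> qn [xn xSn]; have n0 : (0 < n)%N := leq_trans unit_modulus_gt0 qn.
(* Exact level [n.+1] of the power is decided modulo p^(n+2), so [x] is expanded to that
   precision. *)
have [|w xw] := @level_expansion n n.+2 x _ xn; first by rewrite n0 leqW.
have [|_ pw] := @expansion_level n x w n0.
  by rewrite -(res_modE x (leqnSn n.+1)) xw.
have [s ws] := expnD1_lift pr w qn.
have [|] := @expansion_level n.+1 (x *+ p)%R (w + p * s) isT.
  by rewrite resMn xw ws.
move=> h1 h2; split => // /h2; rewrite dvdn_addl ?dvdn_mulr// => /pw.
exact: xSn.
Qed.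

Lemma exact_levelXn n j x : (q <= n)%N -> exact_level n x ->
  exact_level (n + j) (x *+ (p ^ j))%R.
Proof.
move=> qn xn; elim: j => [|j IH]; first by rewrite addn0 expn0.
rewrite addnS expnSr mulrnA; apply: exact_levelX => //.
exact: leq_trans (leq_addr _ _).
Qed.

Lemma exact_levelP x : level q x -> x <> 0%R -> exists2 n, (q <= n)%N & exact_level n x.
Proof.
move=> xq x0; have /existsNP[m0 hm0] : ~ forall n, level n x by move/level_inj.
have h : exists n, `[< ~ level n x >] by exists m0; apply/asboolP.
case: (ex_minnP h) => m /asboolP xm mmin.
have qm : (q < m)%N by rewrite ltnNge; apply/negP => mq; exact/xm/(level_le mq).
case: m xm mmin qm => // m xm mmin qm; exists m => //; split => //.
by apply: contrapT => /asboolP/mmin; rewrite ltnn.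
Qed.

(** Modulo p^(n+1), raising 1 + p^n w to the power c gives 1 + c p^n w, and w is invertible modulo
    p. By Fermat w^(p-2) is its inverse, so c = b w^(p-2) reaches 1 + p^n b. *)
Lemma level_solve n x z : (0 < n)%N -> exact_level n x -> level n z ->
  exists c, res (x *+ c)%R n.+1 = res z n.+1.
Proof.
move=> n0 [xn xSn] zn.
have [|w xw] := @level_expansion n n.+1 x _ xn; first by rewrite n0 leqnSn.
have [|b zb] := @level_expansion n n.+1 z _ zn; first by rewrite n0 leqnSn.
have [|_ pw] := @expansion_level n x w n0; first by rewrite -xw res_mod.
have cwp : coprime w p.
  by rewrite coprime_sym prime_coprime//; apply/negP => /pw.
exists (b * w ^ p.-2)%N; rewrite resMn xw -[RHS]res_mod zb.
have [r ->] := binomial_expansion1 (p ^ n * w) (b * w ^ p.-2).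
have -> : (p ^ n * w) ^ 2 * r = (p ^ n.-1 * w ^ 2 * r) * p ^ n.+1.
  by case: n n0 {xn xSn zn xw zb pw} => // n _; rewrite /= !expnS; ring.
rewrite addnC modnMDl; apply/eqP; rewrite eqn_modDl.
have -> : b * w ^ p.-2 * (p ^ n * w) = p ^ n * (b * w ^ p.-1).
  rewrite -[p.-1]prednK; last by case: (p) p_gt1 => [|[]].
  by rewrite expnSr; ring.
rewrite expnSr -!muln_modr eqn_pmul2l ?expn_gt0 ?p_gt0// -modnMmr.
by rewrite -(totient_prime pr) (Euler_exp_totient cwp) modnMmr muln1.
Qed.

Definition usub V := V 0%R /\ forall x y, V x -> V y -> V (x - y)%R.

Lemma usubN V x : usub V -> V x -> V (- x)%R.
Proof. by move=> [V0 VB] Vx; rewrite -sub0r; exact: VB. Qed.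

Lemma usubD V x y : usub V -> V x -> V y -> V (x + y)%R.
Proof.
by move=> uV Vx Vy; rewrite -[y]opprK; apply: uV.2 => //; exact: usubN.
Qed.

Lemma usubMn V x e : usub V -> V x -> V (x *+ e)%R.
Proof.
move=> uV Vx; elim: e => [|e IH]; first by rewrite mulr0n; exact: uV.1.
by rewrite mulrS; exact: usubD.
Qed.

Definition res_closed V :=
  forall x, (forall n, exists2 y, V y & res y n = res x n) -> V x.

Definition uopen V n := forall x, level n x -> V x.
(** For subgroups this singles out the finite ones: [utf_torsion] identifies them with groups of
    roots of unity. *)
Definition utf V := forall x, V x -> level q x -> x = 0%R.

(** Successive approximation: the p^m-th power of [x] has exact level n + m, so one of its powers
    corrects the next digit of an approximation of [y] inside [V]; closedness of [V] gives [y]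
    itself. *)
Lemma exact_level_uopen V n x : usub V -> res_closed V -> (q <= n)%N ->
  V x -> exact_level n x -> uopen V n.
Proof.
move=> uV cV qn Vx xn y yn; apply: cV => m.
suff [z Vz zy] : exists2 z, V z & res z (n + m) = res y (n + m).
  by exists z => //; exact: eq_res_le (leq_addl _ _) zy.
elim: m => [|m [z Vz zy]]; first by exists 0%R; [exact: uV.1|rewrite addn0].
have [||c hc] := @level_solve (n + m) (x *+ (p ^ m))%R (y - z)%R _
    (exact_levelXn m qn xn).
- by apply: leq_trans (leq_addr _ _); exact: leq_trans unit_modulus_gt0 qn.
- exact: (iffLR (eq_res_level y z _) (esym zy)).
exists (x *+ (p ^ m) *+ c + z)%R.
  by apply: usubD => //; do 2 apply: usubMn => //.
by rewrite addnS -[y in RHS](subrK z); exact: eq_resD.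
Qed.

Lemma utf_or_uopen V : usub V -> res_closed V ->
  utf V \/ exists2 n, (q <= n)%N & uopen V n.
Proof.
move=> uV cV; have [?|/existsNP[x]] := pselect (utf V); first by left.
move=> /not_implyP[Vx /not_implyP[xq x0]]; right.
have [n qn xn] := exact_levelP xq x0.
by exists n => //; exact: exact_level_uopen Vx xn.
Qed.

Lemma exact_level_ex n : (0 < n)%N -> exists x, exact_level n x.
Proof.
move=> n0; exists (@mk_unit p pr (fun=> 1 + p ^ n)%N (fun=> erefl)
  (coprime_one_plus p n0)).
have [|h1 h2] := @expansion_level n (@mk_unit p pr (fun=> 1 + p ^ n)%N
  (fun=> erefl) (coprime_one_plus p n0)) 1 n0; first by rewrite muln1.
split=> // /h2; rewrite dvdn1 => /eqP p1.
by move: p_gt1; rewrite p1.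
Qed.

Lemma utf_not_uopen V n : utf V -> ~ uopen V n.
Proof.
move=> tV oV; have [|x [xn xSn]] := @exact_level_ex (maxn q n).
  by rewrite leq_max unit_modulus_gt0.
apply: xSn; rewrite (tV x) //.
  by apply: oV; apply: level_le xn; exact: leq_maxr.
by apply: level_le xn; exact: leq_maxl.
Qed.

End PadicUnits2.

Lemma primitive_root_mod_prime (p : nat) : prime p -> exists g,
  [/\ coprime g p, forall e, g ^ e = 1 %[mod p] -> p.-1 %| e &
      forall a, coprime a p -> exists j, a = g ^ j %[mod p] ].
Proof.
move=> pr.
have p1 : (0 < p.-1)%N by rewrite -subn1 subn_gt0 prime_gt1.
have expF (x : 'F_p) : (x != 0 -> x ^+ p.-1 = 1)%R.
  move=> x0; apply: (mulfI x0); rewrite -exprS prednK ?prime_gt0// mulr1.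
  by rewrite -[X in (_ ^+ X)%R](card_Fp pr) expf_card.
have : has (p.-1).-primitive_root%R [seq x <- enum 'F_p | x != 0%R].
  apply: has_prim_root => //.
  - by apply/allP => x; rewrite mem_filter => /andP[x0 _]; apply/unity_rootP/expF.
  - by rewrite filter_uniq ?enum_uniq.
  - have := cardC1 (0%R : 'F_p); rewrite card_Fp// => <-.
    rewrite cardE; apply: uniq_leq_size; first exact: enum_uniq.
    by move=> x; rewrite mem_enum mem_filter inE mem_enum => ->.
move=> /hasP[z _ zP].
have natF (a : nat) : coprime a p -> (a%:R != 0 :> 'F_p)%R.
  move=> cap; rewrite -val_eqE /= val_Fp_nat//; apply/negP => /eqP a0.
  by move: cap; rewrite coprime_sym prime_coprime// /dvdn a0.
have eqF (a b : nat) : (a%:R = b%:R :> 'F_p)%R <-> a = b %[mod p].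
  split=> [/(congr1 val)|ab]; first by rewrite /= !val_Fp_nat.
  by apply: val_inj; rewrite /= !val_Fp_nat.
have zE : ((val z)%:R = z :> 'F_p)%R by rewrite natr_Zp.
exists (val z); split.
- rewrite coprime_sym prime_coprime//; apply/negP => pz.
  have z0 : (z = 0)%R.
    by rewrite -zE; apply: (iffRL (eqF _ 0%N)); rewrite mod0n; exact/eqP.
  have := prim_expr_order zP; rewrite z0 expr0n.
  by case: (p.-1) p1 => // n _ /eqP; rewrite eq_sym oner_eq0.
- move=> e /(iffRL (eqF _ _)); rewrite natrX zE => ze.
  by rewrite (prim_order_dvd zP) ze.
- move=> a /natF/expF/(prim_rootP zP)[j aj]; exists j; apply/eqF.
  by rewrite natrX zE.
Qed.

(** * Roots of unity and finite subgroups of the units *)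

Section Torsion.
Variables (p : nat) (pr : prime p).
Local Notation U := (zunits pr).
Local Notation q := (unit_modulus p).
Implicit Types (x y z : U) (V : set U).

Let p_gt0 : (0 < p)%N := prime_gt0 pr.
Let p_gt1 : (1 < p)%N := prime_gt1 pr.

(* The number of roots of unity in Q_p. *)
Definition torsion_order := if odd p then p.-1 else 2.
Local Notation M := torsion_order.

Lemma torsion_order_gt0 : (0 < M)%N.
Proof.
by rewrite /M; case: ifP => // _; rewrite -subn1 subn_gt0.
Qed.

(** A nontrivial [x] has an exact level n. For p = 2 squaring raises it to n + 1; for odd p the
    power p - 1, prime to p, preserves it. Neither result is trivial. *)
Lemma level_torsion_free x : level q x -> (x *+ M = 0)%R -> x = 0%R.
Proof.
move=> xq xM; apply: contrapT => x0; have [n qn xn] := exact_levelP xq x0.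
have n0 : (0 < n)%N := leq_trans (unit_modulus_gt0 p) qn.
move: xM; rewrite /M; case: ifP => [oddp|/negbT/(prime_oddPn pr) p2] xM; last first.
  have [_] := exact_levelX qn xn; apply.
  by move: xM; rewrite -p2 => ->.
have [xl xSl] := xn.
have [|w xw] := @level_expansion _ pr n n.+1 x _ xl; first by rewrite n0 leqnSn.
have [|_ pw] := @expansion_level _ pr n x w n0; first by rewrite -xw res_mod.
have [r hr] := binomial_expansion1 (p ^ n * w) p.-1.
have [|_ [+ _]] := @expansion_level _ pr n (x *+ p.-1)%R (p.-1 * w) n0.
  rewrite resMn xw hr.
  have -> : (p ^ n * w) ^ 2 * r = (p ^ n.-1 * w ^ 2 * r) * p ^ n.+1.
    by case: (n) n0 => // m _; rewrite /= !expnS; ring.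
  by rewrite addnC modnMDl; congr ((1 + _) %% _); ring.
rewrite xM => /(_ erefl); rewrite Euclid_dvdM// => /orP[|/pw//].
by move/dvdn_leq; rewrite -subn1 subn_gt0 p_gt1 => /(_ isT); lia.
Qed.

Lemma root_of_unity : exists z : U,
  (forall e, (z *+ e = 0)%R <-> M %| e) /\
  forall x, exists j, res x q = res (z *+ j)%R q.
Proof.
rewrite /M /unit_modulus; case: ifP => [oddp|/negbT/(prime_oddPn pr) p2].
  have [g [cg gord ggen]] := primitive_root_mod_prime pr.
  have gp : g ^ p = g %[mod p].
    rewrite -[p in g ^ p]prednK// expnS -modnMmr -(totient_prime pr).
    by rewrite (Euler_exp_totient cg) modnMmr muln1.
  have gphi n : g ^ (p.-1 * p ^ n) = 1 %[mod p ^ n.+1].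
    rewrite -[(p.-1 * _)%N]/(p.-1 * p ^ n.+1.-1)%N -totient_pfactor//.
    by apply: Euler_exp_totient; rewrite coprimeXr.
  (* the Teichmueller representative of [g], i.e. the limit of [g ^ (p ^ n)] *)
  have compat n : g ^ (p ^ n.+1) = g ^ (p ^ n) %[mod p ^ n].
    case: n => [|n]; first by rewrite expn0 !modn1.
    have -> : (p ^ n.+2 = p ^ n.+1 + p.-1 * p ^ n * p)%N.
      by rewrite !expnS; case: (p) p_gt0 => // m _; rewrite /=; ring.
    rewrite expnD -modnMmr [g ^ (_ * p)]expnM -modnXm gphi modnXm exp1n.
    by rewrite modnMmr muln1.
  have cg1 : coprime (g ^ (p ^ 1)) p by rewrite coprimeXl.
  pose z : U := mk_unit pr compat cg1.
  have z1 j : res (z *+ j)%R 1 = g ^ j %% p.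
    by rewrite resMn res_mk !expn1 modnXm -modnXm gp modnXm.
  exists z; split => [e|x].
    split=> [ze|/dvdnP[e' ->]].
      by apply: gord; rewrite -z1 ze res0 expn1.
    rewrite mulnC mulrnA; suff -> : (z *+ p.-1 = 0)%R by rewrite mul0rn.
    apply: level_inj => -[|n].
      by rewrite /level -[LHS]res_mod -[RHS]res_mod expn0 !modn1.
    rewrite /level resMn res_mk modnXm -expnM.
    have -> : (p ^ n.+1 * p.-1 = p.-1 * p ^ n * p)%N by rewrite expnS; ring.
    by rewrite expnM -modnXm gphi modnXm exp1n res0.
  have [j xj] := ggen _ (coprime_res1 x).
  by exists j; rewrite z1 -xj -[in LHS]res_mod expn1.
(* For p = 2 the root of unity is -1, with residues 2^n - 1; together with 1 it represents all units
   modulo 4. *)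
have compat n : (p ^ n.+1 - 1 = p ^ n - 1 %[mod p ^ n])%N.
  rewrite p2; have -> : (2 ^ n.+1 - 1 = 2 ^ n + (2 ^ n - 1))%N.
    by rewrite expnS; have := expn_gt0 2 n; lia.
  by rewrite modnDl.
have c1 : coprime (p ^ 1 - 1) p by rewrite p2.
pose z : U := mk_unit pr compat c1.
have z2 : (z *+ 2 = 0)%R.
  apply: level_inj => n; rewrite /level resMn res_mk modnXm res0 p2.
  have [m ->] : exists m, (2 ^ n = m.+1)%N.
    by exists (2 ^ n).-1; rewrite prednK// expn_gt0.
  rewrite subn1 /=; case: m => [|m]; first by rewrite !modn1.
  have -> : (m.+1 ^ 2 = m * m.+2 + 1)%N by ring.
  by rewrite modnMDl.
have zr2 : res z 2 = 3 by rewrite res_mk p2.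
exists z; split => [e|x].
  have ze : (z *+ e = if odd e then z else 0)%R.
    rewrite -[e in LHS]odd_double_half mulrnDr -mul2n mulrnA z2 mul0rn addr0.
    by case: odd.
  rewrite ze dvdn2; case: (odd e) => //=; split=> // z0.
  by move: zr2; rewrite z0 res0 p2.
have : (res x 2 == 1) || (res x 2 == 3).
  move: (res x 2) (res_lt x 2) (coprime_res x 2); rewrite p2.
  by move=> [|[|[|[|]]]].
move=> /orP[] /eqP ->; last by exists 1%N; rewrite zr2.
by exists 0%N; rewrite mulr0n res0 p2.
Qed.

Definition torsion d : set U := [set x | (x *+ d = 0)%R].

Lemma torsion_usub d : usub (torsion d).
Proof.
split; first by rewrite /torsion /= mul0rn.
by move=> x y; rewrite /torsion /= mulrnBl => -> ->; rewrite subr0.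
Qed.

Lemma torsion_closed d : res_closed (torsion d).
Proof.
move=> x hx; apply: level_inj => n; have [y yd xy] := hx n.
by rewrite /level -(eq_resMn d xy) (_ : (y *+ d)%R = 0%R).
Qed.

Lemma torsion_utf d : d %| M -> utf (torsion d).
Proof.
move=> /dvdnP[e eM] x xd xq; apply: level_torsion_free => //.
by rewrite eM mulnC mulrnA xd mul0rn.
Qed.

(** The power M / a of the generator [z] has order exactly a, so it lies in [torsion b] only if a
    divides b. *)
Lemma torsion_inj d e : d %| M -> e %| M -> torsion d = torsion e -> d = e.
Proof.
suff h a b : a %| M -> b %| M -> torsion a = torsion b -> a %| b.
  by move=> dM eM de; apply/eqP; rewrite eqn_dvd (h d e)//=; exact: h.
move=> aM bM ab; have [z [zM _]] := root_of_unity.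
have : torsion a (z *+ (M %/ a))%R.
  by rewrite /torsion /= -mulrnA divnK//; apply/zM.
have Ma0 : (0 < M %/ a)%N.
  rewrite divn_gt0; first exact: dvdn_leq torsion_order_gt0 aM.
  exact: dvdn_gt0 torsion_order_gt0 aM.
rewrite ab /torsion /= -mulrnA => /zM; rewrite -{1}(divnK aM).
by rewrite dvdn_pmul2l.
Qed.

(** Each [x] in [V] is congruent to a power of [z], so its M-th power has level [q] and is trivial
    by [utf]. The quotient of [x] by that power of [z] is then torsion of level [q], hence trivial.
    So [V] consists of powers of [z], and the least exponent [d0] gives d = M / d0. *)
Lemma utf_torsion V : usub V -> utf V -> exists2 d, d %| M & V = torsion d.
Proof.
move=> uV tV; have [z [zM zgen]] := root_of_unity.
have zV x : (x *+ M = 0)%R -> exists j, x = (z *+ j)%R.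
  move=> xM; have [j xj] := zgen x; exists j.
  apply: subr0_eq; apply: level_torsion_free.
    exact: (iffLR (eq_res_level _ _ _) xj).
  by rewrite mulrnBl xM -mulrnA (iffRL (zM _)) ?subr0// dvdn_mull.
have VM x : V x -> (x *+ M = 0)%R.
  move=> Vx; apply: tV; first exact: usubMn.
  have [j xj] := zgen x; rewrite /level (eq_resMn M xj) -mulrnA.
  by rewrite (_ : (z *+ _)%R = 0%R)//; apply/zM/dvdn_mull.
have ex : exists e, (0 < e)%N && `[< V (z *+ e)%R >].
  exists M; rewrite torsion_order_gt0; apply/asboolP.
  by rewrite (_ : (z *+ _)%R = 0%R); [exact: uV.1|exact/zM].
case: (ex_minnP ex) => d0 /andP[d00 /asboolP Vd0] mind0.
have Vz j : V (z *+ j)%R <-> d0 %| j.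
  split=> [Vj|/dvdnP[i ->]]; last by rewrite mulnC mulrnA; exact: usubMn.
  have Vr : V (z *+ (j %% d0))%R.
    have -> : (z *+ (j %% d0) = z *+ j - z *+ d0 *+ (j %/ d0))%R.
      by rewrite {2}(divn_eq j d0) mulrnDr mulnC mulrnA addrC addrA addNr add0r.
    by apply: uV.2 => //; exact: usubMn.
  apply: contraT; rewrite /dvdn -lt0n => r0.
  have : (0 < j %% d0)%N && `[< V (z *+ (j %% d0))%R >].
    by rewrite r0; apply/asboolP.
  by move/mind0; rewrite leqNgt ltn_pmod.
have d0M : d0 %| M by apply/Vz; rewrite (_ : (z *+ _)%R = 0%R); [exact: uV.1|exact/zM].
exists (M %/ d0); first by apply/dvdnP; exists d0; rewrite mulnC divnK.
apply/seteqP; split=> x; rewrite /torsion /=.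
  move=> Vx; have [j xj] := zV _ (VM _ Vx); move: Vx; rewrite xj.
  move/Vz => /dvdnP[i ->]; rewrite -mulrnA; apply/zM.
  by rewrite -mulnA [(d0 * _)%N]mulnC divnK// dvdn_mull.
move=> xd; have xM : (x *+ M = 0)%R.
  by rewrite -(divnK d0M) mulrnA xd mul0rn.
have [j xj] := zV _ xM; move: xd; rewrite xj -mulrnA => /zM.
rewrite -{1}(divnK d0M) mulnC dvdn_pmul2r; first by move/Vz.
rewrite divn_gt0//; exact: dvdn_leq torsion_order_gt0 d0M.
Qed.

End Torsion.

(** * Closed subgroups of the multiplicative group of p-adic numbers *)

Definition qgroup (p : nat) (pr : prime p) : Type := Qpx p.

Section PadicGroup.
Variables (p : nat) (pr : prime p).
Local Notation U := (zunits pr).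
Local Notation G := (qgroup pr).

Local Open Scope ring_scope.

HB.instance Definition _ := Choice.copy G (Qpx p).

Definition deg (g : G) : int := projT1 g.
Definition unt (g : G) : U := projT2 g.
Definition mkq (k : int) (u : U) : G := existT _ k u.

Lemma qgroup_eq (g h : G) : deg g = deg h -> unt g = unt h -> g = h.
Proof. by case: g h => k u [l w] /= -> ->. Qed.

Let qadd (g h : G) : G := qpx_mul g h.
Let qzero : G := mkq 0 0.
Let qopp (g : G) : G := mkq (- deg g) (- unt g).

Fact qaddA : associative qadd.
Proof.
by move=> x y z; apply: qgroup_eq; [exact: addrA|exact: (@addrA U)].
Qed.

Fact qaddC : commutative qadd.
Proof.
by move=> x y; apply: qgroup_eq; [exact: addrC|exact: (@addrC U)].
Qed.

Fact qadd0 : left_id qzero qadd.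
Proof. by move=> x; apply: qgroup_eq; [exact: add0r|exact: (@add0r U)]. Qed.

Fact qaddN : left_inverse qzero qopp qadd.
Proof. by move=> x; apply: qgroup_eq; [exact: addNr|exact: (@addNr U)]. Qed.

HB.instance Definition _ := GRing.isZmodule.Build G qaddA qaddC qadd0 qaddN.

Lemma degD (g h : G) : deg (g + h) = deg g + deg h. Proof. by []. Qed.
Lemma untD (g h : G) : unt (g + h) = unt g + unt h. Proof. by []. Qed.
Lemma degN (g : G) : deg (- g) = - deg g. Proof. by []. Qed.
Lemma untN (g : G) : unt (- g) = - unt g. Proof. by []. Qed.
Lemma mkqD k l u w : mkq k u + mkq l w = mkq (k + l) (u + w). Proof. by []. Qed.
Lemma mkqN k u : - mkq k u = mkq (- k) (- u). Proof. by []. Qed.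
Lemma mkqB k l u w : mkq k u - mkq l w = mkq (k - l) (u - w). Proof. by []. Qed.

Lemma mkqMn k u n : mkq k u *+ n = mkq (k *+ n) (u *+ n).
Proof. by elim: n => // n IH; rewrite !mulrS IH mkqD. Qed.

Lemma mkqMz k u (j : int) : mkq k u *~ j = mkq (k * j) (u *~ j).
Proof.
rewrite -[k * j](mulrzz k j); case: j => n; first exact: mkqMn.
by rewrite !NegzE !mulrNz; exact: (congr1 -%R (mkqMn k u n.+1)).
Qed.

Lemma mkqE (g : G) : mkq (deg g) (unt g) = g. Proof. by case: g. Qed.

Lemma qpx_subgroupP (H : set G) :
  qpx_subgroup (H : set (Qpx p)) <->
  H 0 /\ forall a b, H a -> H b -> H (a - b).
Proof.
split=> [[[h Hh] HB]|[H0 HB]].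
  split; first by apply: (HB h h) => //; exact: (@add0r G).
  by move=> a b Ha Hb; apply: (HB a b) => //; exact: (@subrK G).
split; first by exists (0 : G).
move=> a b c Ha Hb cb; suff -> : c = (a : G) - (b : G) by exact: HB.
by rewrite -cb; exact: (esym (@addrK G b c)).
Qed.

Definition qclass n (g : G) : set G :=
  [set h | deg g = deg h /\ res (unt g) n = res (unt h) n].

Definition qball n : set G := [set g | (absz (deg g) <= n)%N].

Lemma Zpu_ultra_base :
  @ultra_base (Zpu p) (fun n x y => res (x : U) n = res (y : U) n).
Proof.
have uA := ub_set_type (agree_ultra_base nat) (zpu_set p).
split=> [//|n x y ->//|n x y z -> ->//|m n x y|x y xy|x A].
- exact: (@eq_res_le p pr).
- by apply: (@res_inj p pr).
rewrite (ub_nbhs uA); split=> -[n nA].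
  exists n => y xy; apply: nA => i ni.
  exact: (@eq_res_le p pr x y i n (ltnW ni) xy).
by exists n.+1 => y xy; apply: nA; exact: (xy n).
Qed.

Lemma Zpu_compact : compact [set: Zpu p].
Proof.
apply: set_type_compact.
have cP : compact [set x : seqs | forall n, [set i | (i < p ^ n)%N] (x n)].
  apply: (@tychonoff _ (fun _ : nat => nat) (fun n => [set i | (i < p ^ n)%N])).
  by move=> n; apply: finite_compact; exact: finite_II.
apply: subclosed_compact cP _; last by move=> x [xz _] n; exact: (xz n).1.
rewrite -openC; apply/(ub_openP (agree_ultra_base nat)) => x nx.
have [/existsNP[n xn]|/contrapT xz] := pselect (~ forall n,
    x n < p ^ n /\ x n.+1 %% p ^ n = x n)%N.
  (* The condition at [n] reads the entries [n] and [n.+1], hence agreement on [n.+2] entries;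
     coprimality reads the entry 1, hence 2 below. *)
  by exists n.+2 => y xy [yz _]; apply: xn; rewrite !xy.
exists 2%N => y xy [yz cy]; apply: nx; split => //.
by rewrite xy.
Qed.

Lemma qpx_ultra_base : @ultra_base (Qpx p) qclass.
Proof.
have uZ := Zpu_ultra_base.
split=> [//|n x y [xy1 xy2]|n x y z [xy1 xy2] [yz1 yz2]|m n x y mn [xy1 xy2]
  |x y xy|].
- by split; exact: esym.
- by split; [exact: etrans yz1|exact: etrans yz2].
- by split => //; exact: eq_res_le xy2.
- apply: qgroup_eq; first by have [] := xy 0%N.
  by apply: res_inj => n; have [] := xy n.
move=> [k u] A; split=> [/(ub_nbhs uZ)[n nA]|[n nA]].
  by exists n => -[l w] [/= kl uw]; rewrite -kl; exact: nA.
apply/(ub_nbhs uZ); exists n => w uw; exact: nA.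
Qed.

Lemma qball_compact n : compact (qball n : set (Qpx p)).
Proof.
have ck k : compact (existT (fun=> Zpu p) k @` [set: Zpu p] : set (Qpx p)).
  apply: continuous_compact Zpu_compact.
  apply: continuous_subspaceT.
  exact: (@existT_continuous int (fun=> Zpu p) k).
elim: n => [|n IH].
  have -> : qball 0 = existT (fun=> Zpu p) 0 @` [set: Zpu p].
    apply/seteqP; split=> [[k u]|_ [u _ <-]] //=.
    by rewrite /qball /= leqn0 absz_eq0 => /eqP ->; exists u.
  exact: ck.
have -> : qball n.+1 = qball n `|` (existT (fun=> Zpu p) n.+1%:Z @` [set: Zpu p]
    `|` existT (fun=> Zpu p) (- n.+1%:Z) @` [set: Zpu p]).
  apply/seteqP; split=> [[k u]|[k u]].
    rewrite /qball /= leq_eqVlt => /predU1P[kn|]; last by left.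
    right; have [->|->] : k = n.+1%:Z \/ k = - n.+1%:Z by rewrite /deg /= in kn; lia.
      by left; exists u.
    by right; exists u.
  rewrite /qball /deg /= => -[kn|[[w _ [<- _]]|[w _ [<- _]]]] /=.
  - exact: leqW.
  - by rewrite leqnn.
  - by rewrite leqnn.
by apply: compactU => //; exact: compactU.
Qed.

Lemma qball_le m n : (m <= n)%N -> qball m `<=` qball n.
Proof. by move=> mn g gm; exact: leq_trans gm mn. Qed.

Lemma qball_cover (g : G) : exists n, qball n g.
Proof. by exists (absz (deg g)); rewrite /qball /=. Qed.

Lemma qball_sat m n g h : qball n g -> qclass m g h -> qball n h.
Proof. by rewrite /qball /= => gn [<- _]. Qed.

Definition qnear := chabauty_near qclass qball.

Lemma CG_ultra_base :
  @ultra_base (CG p) (fun n H H' => qnear n (val H) (val H')).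
Proof.
apply: chabauty_ultra_base.
- exact: qpx_ultra_base.
- exact: qball_compact.
- exact: qball_le.
- exact: qball_cover.
- exact: qball_sat.
- by move=> H [].
Qed.

Lemma CG_compact : compact [set: CG p].
Proof.
apply: (chabauty_compact qpx_ultra_base qball_compact qball_le qball_cover
  qball_sat); first by move=> H [].
move=> F UF; have FF : Filter F by have [] := @ultra_proper _ _ UF.
split; first exact: (hits_lim_closed qpx_ultra_base).
apply/qpx_subgroupP; split=> [n|a b Fa Fb n].
  apply: (@filterS _ _ _ setT); last exact: filterT.
  move=> H _; exists (0 : G) => //.
  by have [_ /qpx_subgroupP[]] := set_valP H.
apply: filterS2 (Fa n) (Fb n) => H [x Hx [ax1 ax2]] [y Hy [by1 by2]].
exists ((x : G) - (y : G)); last first.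
  split; first by rewrite !degD !degN ax1 by1.
  exact: eq_resB.
by have [_ /qpx_subgroupP[_]] := set_valP H; apply.
Qed.

End PadicGroup.

(** * Normal form of closed subgroups and their closeness *)

Section ClosedSubgroups.
Variables (p : nat) (pr : prime p).
Local Notation U := (zunits pr).
Local Notation G := (qgroup pr).
Local Notation q := (unit_modulus p).
Implicit Types (V : set U) (H : set G) (m n : nat) (u : U).
Local Open Scope ring_scope.

Lemma eq_resMz (x y : U) (j : int) n :
  res x n = res y n -> res (x *~ j) n = res (y *~ j) n.
Proof.
move=> xy; case: j => k; first exact: eq_resMn.
by rewrite NegzE !mulrNz; apply: eq_resN; exact: eq_resMn.
Qed.

(* The subgroup generated by [V] and [(m, u)]. *)
Definition gen V m u : set G :=
  [set g | exists j : int, deg g = m%:Z * j /\ V (unt g - u *~ j)].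

Definition units_of H : set U := [set u | H (mkq 0 u)].

Lemma closed_subgroupsP H : closed_subgroups p H <->
  [/\ forall g, (forall n, hits (@qclass p pr) n H g) -> H g, H 0 &
      forall a b, H a -> H b -> H (a - b)].
Proof.
have uE := qpx_ultra_base pr.
split=> [[/(closed_hitsP uE) clH /(@qpx_subgroupP _ pr)[H0 HB]]//|[clH H0 HB]].
by split; [exact/(closed_hitsP uE)|exact/(@qpx_subgroupP _ pr)].
Qed.

Section OneSubgroup.
Variable H : set G.
Hypothesis cH : closed_subgroups p H.

Let clH : forall g, (forall n, hits (@qclass p pr) n H g) -> H g.
Proof. by have /closed_subgroupsP[] := cH. Qed.

Lemma subgroup0 : H 0. Proof. by have /closed_subgroupsP[] := cH. Qed.

Lemma subgroupB a b : H a -> H b -> H (a - b).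
Proof. by have /closed_subgroupsP[_ _] := cH; apply. Qed.

Lemma subgroupN a : H a -> H (- a).
Proof. by rewrite -sub0r; apply: subgroupB; exact: subgroup0. Qed.

Lemma subgroupD a b : H a -> H b -> H (a + b).
Proof. by move=> Ha Hb; rewrite -[b]opprK; exact/subgroupB/subgroupN. Qed.

Lemma subgroupMz a (j : int) : H a -> H (a *~ j).
Proof.
move=> Ha; have h n : H (a *+ n).
  elim: n => [|n IH]; first by rewrite mulr0n; exact: subgroup0.
  by rewrite mulrS; exact: subgroupD.
by case: j => n; [exact: h|rewrite NegzE mulrNz; exact/subgroupN/h].
Qed.

Lemma units_of_usub : usub (units_of H).
Proof.
split; first exact: subgroup0.
by move=> x y Hx Hy; exact: (subgroupB Hx Hy).
Qed.

Lemma units_of_res_closed : res_closed (units_of H).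
Proof.
move=> x hx; apply: clH => n; have [y Hy yx] := hx n.
by exists (mkq 0 y) => //; split.
Qed.

(** Euclidean division by the least positive degree. The convention that [u] is trivial when [m] is
    0 keeps [gen] from enlarging the unit part by powers of [u]. *)
Lemma closed_subgroup_gen :
  exists m u, (m = 0%N -> u = 0) /\ H = gen (units_of H) m u.
Proof.
have [[k [w [k0 Hkw]]]|noH] := pselect (exists k w, k <> 0 /\ H (mkq k w));
    last first.
  exists 0%N, 0; split => //; apply/seteqP; split=> g.
    move=> Hg; exists 0; rewrite mul0r mulr0z subr0 /units_of /=.
    have g0 : deg g = 0.
      by apply: contrapT => g0; apply: noH; exists (deg g), (unt g); rewrite mkqE.
    by rewrite -[X in mkq X _]g0 mkqE.
  by move=> [j [gj]]; rewrite mul0r in gj; rewrite mul0rz subr0 /units_of /= -gj mkqE.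
have ex : exists n, (0 < n)%N && `[< exists w, H (mkq n%:Z w) >].
  exists (absz k); rewrite absz_gt0; apply/andP; split; first exact/eqP.
  apply/asboolP; case: k k0 Hkw => n k0 Hkw; first by exists w.
  by exists (- w); have := subgroupN Hkw; rewrite mkqN NegzE opprK.
case: (ex_minnP ex) => m /andP[m0 /asboolP[u Hu]] minm.
have m0' : (m%:Z != 0) by rewrite eqz_nat -lt0n.
exists m, u; split=> [m0''|]; first by rewrite m0'' in m0.
apply/seteqP; split=> g.
  move=> Hg; have := subgroupB Hg (subgroupMz (deg g %/ m)%Z Hu).
  rewrite mkqMz -[g in X in X -> _]mkqE mkqB.
  have -> : deg g - m%:Z * (deg g %/ m)%Z = (deg g %% m)%Z.
    by rewrite {1}(divz_eq (deg g) m) mulrC addrC addKr.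
  have := modz_ge0 (deg g) m0'; have := ltz_pmod (deg g) (_ : 0 < m%:Z).
  have := divz_eq (deg g) m.
  case: (deg g %% m)%Z => // r degg rm _ Hr.
  exists (deg g %/ m)%Z.
  have r0 : r = 0%N.
    apply/eqP; rewrite -leqn0 leqNgt; apply/negP => r0.
    have : (0 < r)%N && `[< exists w, H (mkq r%:Z w) >].
      by rewrite r0; apply/asboolP; eexists; exact: Hr.
    by move/minm; rewrite leqNgt -ltz_nat rm.
  by rewrite r0 in Hr degg; split; first by rewrite [LHS]degg addr0 mulrC.
move=> [j [gj Vg]]; have := subgroupD (subgroupMz j Hu) Vg.
by rewrite mkqMz mkqD addr0 -gj addrC subrK mkqE.
Qed.

Lemma mem_qclass n g h : uopen (units_of H) n -> H g -> qclass n g h -> H h.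
Proof.
move=> oV Hg [dgh ugh]; have /(subgroupD Hg) : H (mkq 0 (unt h - unt g)).
  by apply: oV; exact: (iffLR (eq_res_level _ _ _) (esym ugh)).
by rewrite -[X in X + _](mkqE g) mkqD addr0 dgh addrC subrK mkqE.
Qed.

End OneSubgroup.

(** All approximations of [g] share its degree, which fixes the power of [(m, u)] involved;
    closedness thus reduces to that of [V]. *)
Lemma gen_closed_subgroup V m u : usub V -> res_closed V ->
  (m = 0%N -> u = 0) -> closed_subgroups p (gen V m u).
Proof.
move=> uV cV mu; apply/closed_subgroupsP; split.
- move=> g hg; have [h0 [j0 [h0j0 _]] [gh0 _]] := hg 0%N.
  exists j0; split; first by rewrite gh0.
  apply: cV => n; have [h [j [hj Vh] [gh1 gh2]]] := hg n.
  have uj : u *~ j = u *~ j0.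
    have [/mu ->|m0] := eqVneq m 0%N; first by rewrite !mul0rz.
    congr (_ *~ _); apply: (@mulfI _ m%:Z); first by rewrite eqz_nat.
    by rewrite -hj -gh1 gh0.
  exists (unt h - u *~ j) => //; rewrite uj.
  by apply: eq_resB.
- by exists 0; rewrite mulr0 mulr0z subr0; split => //; exact: uV.1.
- move=> a b [i [ai Va]] [j [bj Vb]]; exists (i - j).
  rewrite degD degN ai bj mulrBr untD untN mulrzBr; split=> //.
  by have := uV.2 _ _ Va Vb; rewrite !opprD addrACA.
Qed.

Lemma units_of_gen V m u : (m = 0%N -> u = 0) -> units_of (gen V m u) = V.
Proof.
move=> mu; apply/seteqP; split=> w; last first.
  by move=> Vw; exists 0; rewrite mulr0 mulr0z subr0.
move=> [j [mj Vw]]; suff uj : u *~ j = 0 by rewrite uj subr0 in Vw.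
have [/mu ->|m0] := eqVneq m 0%N; first by rewrite mul0rz.
have /eqP := esym mj; rewrite mulf_eq0 eqz_nat (negPf m0) => /eqP ->.
by rewrite mulr0z.
Qed.

Definition sub_res n V V' := forall v, V v -> exists2 v', V' v' & res v n = res v' n.

Lemma gen_near n V V' m u u' : sub_res n V V' -> sub_res n V' V ->
  res u n = res u' n -> qnear pr n (gen V m u) (gen V' m u').
Proof.
suff h W W' w w' g : sub_res n W W' -> res w n = res w' n ->
    hits (@qclass p pr) n (gen W m w) g -> hits (@qclass p pr) n (gen W' m w') g.
  by move=> VV' V'V uu' g _; split; apply: h.
move=> WW' ww' [h [j [hj Wh]] [gh1 gh2]]; have [v' Wv' vv'] := WW' _ Wh.
exists (mkq (m%:Z * j) (v' + w' *~ j)).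
  by exists j; rewrite addrK.
split; first by rewrite gh1.
rewrite gh2 -[unt h in LHS](subrK (w *~ j)); apply: eq_resD => //.
exact: eq_resMz.
Qed.

(** Within degrees at most [n], a generator of degree [m] larger than [n] contributes only its
    trivial power. *)
Lemma gen_near0 n V V' m u : sub_res n V V' -> sub_res n V' V -> (n < m)%N ->
  qnear pr n (gen V 0 0) (gen V' m u).
Proof.
move=> VV' V'V nm g gn; split=> -[h [j [hj Vh]] [gh1 gh2]].
  rewrite mul0r in hj; rewrite mul0rz subr0 in Vh.
  have [v' Vv' hv'] := VV' _ Vh; exists (mkq 0 v').
    by exists 0; rewrite mulr0 mulr0z subr0.
  by split; [rewrite gh1 hj|rewrite gh2].
have j0 : j = 0.
  have : (m * absz j <= n)%N by move: gn; rewrite /qball /= gh1 hj abszM.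
  have [//|j0] := eqVneq j 0; rewrite -absz_gt0 in j0.
  by move=> /(leq_trans (leq_pmulr m j0)); rewrite leqNgt nm.
rewrite j0 mulr0 in hj; rewrite j0 mulr0z subr0 in Vh.
have [v Vv hv] := V'V _ Vh; exists (mkq 0 v).
  by exists 0; rewrite mul0r mulr0z subr0.
by split; [rewrite gh1 hj|rewrite gh2].
Qed.

(** Precision [n.+1] lets [H'] contain a unit congruent to one of exact level [n], hence of exact
    level [n] itself; its unit part then contains all of level [n]. Both unit parts are unions of
    the same cosets, so they coincide. *)
Lemma near_units_of n H H' : closed_subgroups p H -> closed_subgroups p H' ->
  (q <= n)%N -> uopen (units_of H) n -> qnear pr n.+1 H H' ->
  uopen (units_of H') n /\ units_of H' = units_of H.
Proof.
move=> cH cH' qn oV HH'.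
have near0 (x : U) : (exists2 y, units_of H y & res x n.+1 = res y n.+1) <->
    (exists2 y, units_of H' y & res x n.+1 = res y n.+1).
  have h K : (exists2 y, units_of K y & res x n.+1 = res y n.+1) <->
      hits (@qclass p pr) n.+1 K (mkq 0 x).
    split=> [[y Ky xy]|[[k y] Ky [/= k0 xy]]]; first by exists (mkq 0 y).
    by exists y => //; rewrite /units_of /= k0.
  rewrite !h; exact: HH'.
have n0 : (0 < n)%N by exact: leq_trans (unit_modulus_gt0 p) qn.
have oV' : uopen (units_of H') n.
  have [x [xn xSn]] := exact_level_ex pr n0.
  have [|x' H'x' xx'] := (near0 x).1; first by exists x => //; exact: oV.
  apply: (exact_level_uopen (units_of_usub cH') (units_of_res_closed cH') qn H'x').
  split; last by rewrite /level -xx'.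
  by rewrite /level -(eq_res_le (leqnSn n) xx').
split=> //; apply/seteqP; split=> x Hx.
  have [|y Hy xy] := (near0 x).2; first by exists x.
  rewrite -[x](subrK y); apply: (usubD (units_of_usub cH)) Hy.
  apply: oV; apply: (iffLR (eq_res_level _ _ _)).
  exact: eq_res_le (leqnSn n) xy.
have [|y Hy xy] := (near0 x).1; first by exists x.
rewrite -[x](subrK y); apply: (usubD (units_of_usub cH')) Hy.
apply: oV'; apply: (iffLR (eq_res_level _ _ _)).
exact: eq_res_le (leqnSn n) xy.
Qed.

Lemma open_fin_indexP (H : CG p) : open_fin_index p H <->
  (exists2 n, (q <= n)%N & uopen (units_of (val H)) n) /\
  exists g : G, (val H : set G) g /\ deg g <> 0.
Proof.
have cH : closed_subgroups p (val H) := set_valP H.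
have uE := qpx_ultra_base pr.
split=> [[oH [S [/finite_seqP[s ->] fS]]]|[[n qn oV] [g [Hg g0]]]]; split.
- have [n nH] := (ub_openP uE _).1 oH _ (subgroup0 cH).
  exists (maxn q n); first exact: leq_maxl.
  move=> x xn; apply: nH; split=> //=; apply/esym.
  by apply: level_le xn; exact: leq_maxr.
- apply: contrapT => nH.
  have H0 (g : G) : (val H : set G) g -> deg g = 0.
    by move=> Hg; apply: contrapT => g0; apply: nH; exists g.
  (* If [H] had only elements of degree 0, finitely many cosets would have bounded degree and miss
     degree B + 1. *)
  pose B := \max_(g <- s) absz (deg (g : G)).
  have [x [h [xs Hh]]] := fS (mkq B.+1%:Z (0 : U)).
  move=> /(congr1 (@deg p pr)); rewrite [RHS](degD (x : G) h) (H0 h Hh) addr0.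
  rewrite /= => /(congr1 absz) /= Bx.
  have : (absz (deg (x : G)) <= B)%N by exact: leq_bigmax_seq.
  by rewrite /deg -Bx ltnn.
- apply/(ub_openP uE) => h Hh; exists n => h'; exact: mem_qclass oV Hh.
- have [m [u [mu eqH]]] := closed_subgroup_gen cH.
  have m0 : (0 < m)%N.
    rewrite lt0n; apply/eqP => m0; move: Hg; rewrite eqH m0 => -[j [gj _]].
    by apply: g0; rewrite gj mul0r.
  (* One unit per residue modulo p^n, with an irrelevant default for numbers that are not residues
     of units. Coset representatives are then p^i [rep a] with i < m. *)
  have /choice[rep hrep] : forall a : nat, exists x : U,
      (exists y : U, res y n = a) -> res x n = a.
    move=> a; have [[y ya]|na] := pselect (exists y : U, res y n = a).
      by exists y.
    by exists 0 => /na.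
  exists [set mkq i%:Z (rep a) | i in `I_m & a in `I_(p ^ n)%N].
  split; first by apply: finite_image2; exact: finite_II.
  move=> h; pose t := (deg (h : G) %/ m)%Z; pose w := unt (h : G) - u *~ t.
  have m0' : m%:Z != 0 by rewrite eqz_nat -lt0n.
  have [i im hi] : exists2 i, (i < m)%N & deg (h : G) = i%:Z + m%:Z * t.
    have := modz_ge0 (deg (h : G)) m0'.
    have := ltz_pmod (deg (h : G)) (_ : 0 < m%:Z).
    have := divz_eq (deg (h : G)) m.
    case: (deg (h : G) %% m)%Z => // r -> rm _; exists r; first exact: rm.
    by rewrite addrC mulrC.
  pose x := mkq i%:Z (rep (res w n)).
  exists x, ((h : G) - x); split.
  + by exists i => //; exists (res w n) => //; exact: res_lt.
  + rewrite eqH; exists t; rewrite degD degN untD untN hi; split.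
      by rewrite addrC addKr.
    rewrite addrAC; apply: oV; apply: (iffLR (eq_res_level _ _ _)).
    by rewrite hrep//; exists w.
  + by rewrite [RHS](_ : _ = x + ((h : G) - x))// addrC subrK.
Qed.

End ClosedSubgroups.

(** * Isolated, dense and accumulating subgroups in the Chabauty space *)

Section ChabautySpace.
Variables (p : nat) (pr : prime p).
Local Notation U := (zunits pr).
Local Notation G := (qgroup pr).
Local Notation q := (unit_modulus p).
Local Notation N := (open_fin_index p).
Implicit Types (V : set U) (H : CG p) (m n : nat) (u : U).
Local Open Scope ring_scope.

Let q_gt0 : (0 < q)%N := unit_modulus_gt0 p.
Let uCG := CG_ultra_base pr.

Definition CG_gen V m u (uV : usub V) (cV : res_closed V)
    (mu : m = 0%N -> u = 0) : CG p :=
  exist _ (gen V m u) (mem_set (gen_closed_subgroup uV cV mu)).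

Lemma gen_sub V m u (K : set G) : closed_subgroups p K -> K (mkq m%:Z u) ->
  V `<=` units_of K -> gen V m u `<=` K.
Proof.
move=> cK Ku VK g [j [gj /VK Vg]]; have := subgroupD cK (subgroupMz cK j Ku) Vg.
by rewrite mkqMz mkqD addr0 -gj addrC subrK mkqE.
Qed.

Lemma gen_generator V m u : usub V -> gen V m u (mkq m%:Z u).
Proof. by move=> uV; exists 1; rewrite mulr1 mulr1z subrr; split=> //; exact: uV.1. Qed.

Lemma deg0_eq (A B : set G) : (forall g, A g -> deg g = 0) ->
  (forall g, B g -> deg g = 0) -> units_of A = units_of B -> A = B.
Proof.
suff h (K L : set G) : (forall g, K g -> deg g = 0) ->
    units_of K = units_of L -> K `<=` L.
  by move=> A0 B0 AB; apply/seteqP; split; apply: h.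
move=> K0 KL g Kg; rewrite -(mkqE g) (K0 _ Kg).
have : units_of K (unt g) by rewrite /units_of /= -(K0 _ Kg) mkqE.
by rewrite KL.
Qed.

(** The open subgroup V(1 + p^n Z_p), indistinguishable from [V] up to level [n]. *)
Definition thick n V : set U := [set x | exists2 v, V v & res x n = res v n].

Lemma thick_usub n V : usub V -> usub (thick n V).
Proof.
move=> uV; split; first by exists 0 => //; exact: uV.1.
move=> x y [v Vv xv] [w Vw yw]; exists (v - w); first exact: uV.2.
exact: eq_resB.
Qed.

Lemma thick_res_closed n V : res_closed (thick n V).
Proof. by move=> x /(_ n)[y [v Vv yv] yx]; exists v => //; rewrite -yx. Qed.

Lemma thick_uopen n V : usub V -> uopen (thick n V) n.
Proof. by move=> uV x xn; exists 0 => //; exact: uV.1. Qed.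

Lemma sub_res_thick m n V : sub_res m V (thick n V).
Proof. by move=> v Vv; exists v => //; exists v. Qed.

Lemma thick_sub_res m n V : (m <= n)%N -> sub_res m (thick n V) V.
Proof. by move=> mn v [w Vw vw]; exists w => //; exact: eq_res_le vw. Qed.

Lemma sub_res_refl n V : sub_res n V V.
Proof. by move=> v Vv; exists v. Qed.

Lemma isolated_open_fin_index H : N H -> open [set H].
Proof.
move=> /(open_fin_indexP pr)[[n qn oV] [g [Hg g0]]].
have cH : closed_subgroups p (val H) := set_valP H.
have [m [u [mu eqH]]] := closed_subgroup_gen cH.
have uV := units_of_usub (pr := pr) cH.
have m0 : (0 < m)%N.
  rewrite lt0n; apply/eqP => m0; move: Hg; rewrite eqH m0 => -[j [gj _]].
  by apply: g0; rewrite gj mul0r.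
have Hu : (val H : set G) (mkq m%:Z u) by rewrite eqH; exact: gen_generator.
(* Level [n.+1] fixes the unit part, and level [m] makes the generator of degree [m] visible. The
   two least degrees then divide each other. *)
apply/(ub_openP uCG) => _ ->; exists (maxn n.+1 m) => H' HH'.
have cH' : closed_subgroups p (val H') := set_valP H'.
have uV' := units_of_usub (pr := pr) cH'.
have [|oV' VV'] := near_units_of cH cH' qn oV.
  by apply: (chabauty_near_le (qpx_ultra_base pr) (@qball_le _ pr)
    (@qball_sat _ pr)) HH'; exact: leq_maxl.
have H'u : (val H' : set G) (mkq m%:Z u).
  have [||h H'h [/= hm hu]] := (HH' (mkq m%:Z u) _).1.
  - by rewrite /qball /=; exact: leq_maxr.
  - by exists (mkq m%:Z u).
  apply: (mem_qclass cH' oV' H'h); split=> //; apply/esym.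
  by apply: eq_res_le hu; rewrite leq_max leqnSn.
have [m' [u' [mu' eqH']]] := closed_subgroup_gen cH'.
have H'u' : (val H' : set G) (mkq m'%:Z u') by rewrite eqH'; exact: gen_generator.
have [j mj] : exists j : int, m%:Z = m'%:Z * j.
  by move: H'u; rewrite eqH' => -[j [mj _]]; exists j.
have m'm : (m' %| m)%N by rewrite -[m]/(absz m%:Z) mj abszM dvdn_mulr.
have [i mi] : exists i : int, m'%:Z = m%:Z * i.
  have [||h] := (HH' (mkq m'%:Z u') _).2.
  - by rewrite /qball /= leq_max (dvdn_leq m0 m'm) orbT.
  - by exists (mkq m'%:Z u').
  by rewrite eqH => -[i [hi _]] [/= m'h _]; exists i; rewrite m'h.
have em : m = m'.
  by apply/eqP; rewrite eqn_dvd m'm andbT -[m']/(absz m'%:Z) mi abszM dvdn_mulr.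
apply/val_inj/seteqP; split; last first.
  by rewrite [X in X `<=` _]eqH; apply: gen_sub => //; rewrite VV'.
rewrite [X in X `<=` _]eqH'; apply: gen_sub => //; last by rewrite VV'.
have := subgroupB cH' H'u' H'u; rewrite mkqB em subrr => Vuu'.
have : units_of (val H) (u' - u) by rewrite -VV'.
move=> /(subgroupD cH Hu); rewrite mkqD addr0 -em.
by rewrite [u + _]addrC subrK.
Qed.

Lemma open_open_fin_index : open N.
Proof.
have -> : N = \bigcup_(H in N) [set H].
  by apply/seteqP; split=> [H NH|_ [H NH ->]//]; exists H.
by apply: bigcup_open => H; exact: isolated_open_fin_index.
Qed.

(** Thicken the unit part to make it open and, if the degree is 0, add a generator of degree [n.+1];
    neither change is seen at level [n]. *)
Lemma dense_open_fin_index : dense N.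
Proof.
move=> O [H OH] /(ub_openP uCG)/(_ H OH)[n nO].
have cH : closed_subgroups p (val H) := set_valP H.
have [m [u [mu eqH]]] := closed_subgroup_gen cH.
have uV := units_of_usub (pr := pr) cH; set V := units_of _ in eqH uV.
pose l := maxn q n; pose W := thick l V.
have uW : usub W := thick_usub l uV.
have VW := @sub_res_thick n l V.
have WV := @thick_sub_res n l V (leq_maxr q n).
suff [m' [u' [m'0 HH']]] : exists m' u', (0 < m')%N /\ qnear pr n (val H) (gen W m' u').
  have m'u' : m' = 0%N -> u' = 0 by move=> m'0'; rewrite m'0' in m'0.
  exists (CG_gen uW (@thick_res_closed _ _) m'u'); split; first exact: nO.
  apply/(open_fin_indexP pr); split.
    exists l; first exact: leq_maxl.
    by rewrite /= units_of_gen//; exact: thick_uopen.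
  exists (mkq m'%:Z u'); split; first exact: gen_generator.
  by move=> /= [] m'0'; rewrite m'0' in m'0.
have [m0|m0] := posnP m; last by exists m, u; split => //; rewrite eqH; exact: gen_near.
exists n.+1, 0; split => //; rewrite eqH m0 mu//; exact: gen_near0.
Qed.

Lemma CG_proper_compactification : proper_compactification_of_N (CG p) N.
Proof.
split.
- exact: CG_compact.
- exact: (ub_metrizable uCG Rdefinitions.R).
- exact: open_open_fin_index.
- apply: (ub_countable_isolated uCG); first exact: CG_compact.
  exact: isolated_open_fin_index.
- split; first exact: dense_open_fin_index.
  move=> H NH; exists [set H]; split => //; first exact: isolated_open_fin_index.
  by apply/seteqP; split=> [H1 []|H1 ->].
Qed.

Local Notation X := (CG_minus_N p).
Implicit Types x y : X.

Definition grp x : set G := val (val x : CG p).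

Let uX := ub_set_type uCG (~` N).

Lemma grp_closed x : closed_subgroups p (grp x).
Proof. exact: (set_valP (val x : CG p)). Qed.

Lemma grp_not_open_fin_index x : ~ N (val x).
Proof. exact: (set_valP x). Qed.

Lemma grp_inj x y : grp x = grp y -> x = y.
Proof. by move=> xy; apply/val_inj/val_inj. Qed.

Lemma uopen_deg0 x n : (q <= n)%N -> uopen (units_of (grp x)) n ->
  forall g, grp x g -> deg g = 0.
Proof.
move=> qn oV g xg; apply: contrapT => g0; apply: (@grp_not_open_fin_index x).
by apply/(open_fin_indexP pr); split; [exists n|exists g].
Qed.

Definition finite_units : set X := [set x | utf (units_of (grp x))].

Lemma not_finite_units x : ~ finite_units x ->
  exists2 n, (q <= n)%N & uopen (units_of (grp x)) n.
Proof.
have cx := grp_closed x.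
by have [|//] := utf_or_uopen (units_of_usub cx) (units_of_res_closed cx).
Qed.

(** Outside [N], an open unit part forces degree 0, so the subgroup is its unit part, which close
    subgroups share; they are in turn of degree 0. *)
Lemma isolated_not_finite_units x : ~ finite_units x -> open [set x].
Proof.
move=> /not_finite_units[n qn oV]; apply/(ub_openP uX) => _ ->; exists n.+1.
move=> y xy; have [oV' VV'] := near_units_of (grp_closed x) (grp_closed y) qn oV xy.
apply/grp_inj/deg0_eq => //; exact: uopen_deg0 qn _.
Qed.

Lemma CG_gen_X (H : CG p) : @utf p pr (units_of (val H)) \/
  (forall g : G, (val H : set G) g -> deg g = 0) -> exists x, grp x = val H.
Proof.
move=> hH; have NH : (~` N) H.
  move=> /(open_fin_indexP pr)[[n qn oV] [g [Hg g0]]].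
  by case: hH => [/utf_not_uopen/(_ oV)//|/(_ g Hg)].
by exists (exist _ H (mem_set NH)).
Qed.

Lemma gen0_deg0 V g : gen V 0 0 g -> deg g = 0.
Proof. by move=> [j [-> _]]; rewrite mul0r. Qed.

Lemma perfect_finite_units n x : finite_units x ->
  exists y, [/\ finite_units y, qnear pr n (grp x) (grp y) & y <> x].
Proof.
move=> tV; have cx := grp_closed x.
have [m [u [mu eqx]]] := closed_subgroup_gen cx.
have uV := units_of_usub (pr := pr) cx; have cV := units_of_res_closed (pr := pr) cx.
rewrite /finite_units /= in tV; set V := units_of _ in eqx uV cV tV.
have [m0|m0] := posnP m.
  (* In degree 0 the perturbation adds a generator too large to be seen. *)
  have mu0 : n.+1 = 0%N -> (0 : U) = 0 by [].
  have [|y yE] := @CG_gen_X (CG_gen uV cV mu0).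
    by left; rewrite /= units_of_gen.
  exists y; split; rewrite ?/finite_units /= ?yE /=.
  - by rewrite units_of_gen.
  - by rewrite eqx m0 mu//; apply: gen_near0 => //; exact: sub_res_refl.
  - move=> xy; have := gen_generator n.+1 0 uV.
    by rewrite -[gen _ _ _]yE xy eqx m0 mu// => /gen0_deg0.
(* In positive degree the generator is multiplied by a nontrivial unit [e] invisible at level [n].
   Since [e] is outside [V], and elements of degree [m] form a single coset of [V], the subgroup
   changes. *)
have [|e [en eSn]] := @exact_level_ex _ pr (maxn q n).
  by rewrite leq_max q_gt0.
have nVe : ~ V e.
  move=> Ve; apply: eSn; rewrite (tV e)//.
  by apply: level_le en; exact: leq_maxl.
have mu0 : m = 0%N -> u + e = 0 by move=> m0'; rewrite m0' in m0.
have [|y yE] := @CG_gen_X (CG_gen uV cV mu0).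
  by left; rewrite /= units_of_gen.
exists y; split; rewrite ?/finite_units /= ?yE /=.
- by rewrite units_of_gen.
- rewrite eqx; apply: gen_near; [exact: sub_res_refl|exact: sub_res_refl|].
  rewrite -[u in LHS]addr0; apply: eq_resD => //; apply/esym.
  by apply: level_le en; exact: leq_maxr.
- move=> xy; have := gen_generator m (u + e) uV.
  rewrite -[gen _ _ _]yE xy eqx => -[j [/= mj Vj]]; apply: nVe.
  have j1 : j = 1.
    have m0' : m%:Z != 0 by rewrite eqz_nat -lt0n.
    by apply: (mulfI m0'); rewrite -mj mulr1.
  by rewrite j1 mulr1z [u + e]addrC addrK in Vj.
Qed.

Local Notation M := (torsion_order p).

(** An element of degree k is seen at level |k| by a close subgroup with open unit part, which has
    degree 0 outside [N]. So k = 0, and the limit is a finite group of units. *)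
Lemma accumulation_finite_units x : finite_units x ->
  (forall n, exists2 y, ~ finite_units y & qnear pr n (grp x) (grp y)) ->
  exists2 d, (d %| M)%N & grp x = gen (@torsion p pr d) 0 0.
Proof.
move=> tV hx; have cx := grp_closed x.
have x0 g : grp x g -> deg g = 0.
  move=> xg; have [y /not_finite_units[n qn oV] xy] := hx (absz (deg g)).
  have [||h yh [-> _]] := (xy g _).1; first exact: leqnn.
    by exists g.
  exact: uopen_deg0 qn oV h yh.
have [d dM Vd] := utf_torsion (units_of_usub cx) tV.
exists d => //; apply: deg0_eq => //; first exact: gen0_deg0.
by rewrite units_of_gen.
Qed.

Lemma CG_minus_N_homeomorphic (k : nat) (c : 'I_k -> cantor_space) :
  k = size (divisors M) -> injective c -> homeomorphic X (glued k c).
Proof.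
move=> kE; pose d (i : 'I_k) := nth 0%N (divisors M) i.
have M0 := torsion_order_gt0 pr.
have dM i : (d i %| M)%N by rewrite dvdn_divisors// mem_nth// -kE.
have /choice[v vE] : forall i, exists x, grp x = gen (@torsion p pr (d i)) 0 0.
  move=> i; have [|x xE] := @CG_gen_X
    (@CG_gen _ 0 0 (torsion_usub pr (d i)) (@torsion_closed _ _ _) (fun=> erefl)).
    by right=> g; exact: gen0_deg0.
  by exists x.
have vV i : units_of (grp (v i)) = torsion (d i) by rewrite vE units_of_gen.
apply: (@homeomorphic_glued _ _ _ finite_units v uX).
- apply: set_type_compact; apply: subclosed_compact (CG_compact pr) _ => //.
  exact/open_closedC/open_open_fin_index.
- rewrite kE lt0n; apply/eqP => /size0nil dM0.
  by have := dvdnn M; rewrite dvdn_divisors// dM0.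
- exact: isolated_not_finite_units.
- exact: perfect_finite_units.
- by move=> i; rewrite /finite_units /= vV; exact: torsion_utf.
- move=> i j vij; have /eqP : d i = d j.
    by apply: (@torsion_inj _ pr) => //; rewrite -!vV vij.
  by rewrite nth_uniq ?divisors_uniq -?kE// => /eqP/val_inj.
- move=> x tx /(accumulation_finite_units tx)[e].
  rewrite dvdn_divisors// -index_mem -kE => ek xE.
  exists (Ordinal ek); apply: grp_inj; rewrite vE xE /d /= nth_index//.
  by rewrite -index_mem -kE.
(* The thickenings of the finite group, kept in degree 0, lie outside [N], have open unit part and
   converge to it. *)
- move=> i n; pose l := maxn q n; pose V := @torsion p pr (d i).
  have uV : usub V := torsion_usub pr (d i).
  have [|y yE] := @CG_gen_X
    (@CG_gen _ 0 0 (thick_usub l uV) (@thick_res_closed _ _) (fun=> erefl)).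
    by right=> g; exact: gen0_deg0.
  exists y.
    rewrite /finite_units /= yE /= units_of_gen// => /utf_not_uopen; apply.
    exact: thick_uopen.
  rewrite /= -[val (val (v i))]/(grp (v i)) -[val (val y)]/(grp y) vE yE.
  apply: gen_near => //; first exact: sub_res_thick.
  by apply: thick_sub_res; exact: leq_maxr.
Qed.

End ChabautySpace.

Theorem theorem1 (p : nat) : prime p ->
  proper_compactification_of_N (CG p) (open_fin_index p) /\
  (odd p -> forall c : 'I_(size (divisors p.-1)) -> cantor_space,
      injective c -> homeomorphic (CG_minus_N p) (glued _ c)) /\
  (p = 2 -> forall c : 'I_2 -> cantor_space,
      injective c -> homeomorphic (CG_minus_N p) (glued 2 c)).
Proof.
move=> pr; split; first exact: CG_proper_compactification.
split=> [oddp|p2] c; apply: (CG_minus_N_homeomorphic pr).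
  by rewrite /torsion_order oddp.
by rewrite /torsion_order p2.
Qed.
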